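(* Let $r,k\in\mathbb Z$, $0\le k\le r$, and consider the local problems on $I_n$ with the same given value in $\mathbb R^d$ at $t_{n-1}^-$. If there is a solution $\widetilde U\in P_{r+1}(I_n,\mathbb R^d)$ of the local collocation problem with multiple nodes $$M\widetilde U^{(i+1)}(t_n^-)=\frac{\mathrm d^i}{\mathrm dt^i}\Big(F\big(t,\widetilde U(t)\big)\Big)\Big|_{t=t_n^-},\qquad i=0,\dots,\lfloor\tfrac k2\rfloor,$$ $$M\widetilde U^{(i+1)}(t_{n-1}^+)=\frac{\mathrm d^i}{\mathrm dt^i}\Big(F\big(t,\widetilde U(t)\big)\Big)\Big|_{t=t_{n-1}^+},\qquad \text{if }k\ge1,\ i=0,\dots,\lfloor\tfrac{k-1}2\rfloor,$$ $$M\widetilde U'(t_{n,i})=F\big(t_{n,i},\widetilde U(t_{n,i})\big),\qquad i=1,\dots,r-k,$$ with $\widetilde U(t_{n-1}^+)$ equal to the given value, then $U=\mathcal I^r_k\widetilde U\in P_r(I_n,\mathbb R^d)$ solves the local problem of $Q^r_k\text{-}\mathbf{VTD}^r_k$ on $I_n$. Furthermore, if $\widetilde U$ is uniquely defined as solution of this collocation problem, then so is $U$ as solution of the local problem of $Q^r_k\text{-}\mathbf{VTD}^r_k$.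
   Context: Problem: $M u'(t)=F(t,u(t))$, $u(t_0)=u_0\in\mathbb R^d$, with $M\in\mathbb R^{d\times d}$ regular; $F$ is sufficiently smooth (all derivatives of $F$ that occur exist and are continuous) and Lipschitz continuous in its second variable. Notation: $I_n=(t_{n-1},t_n]$ is a subinterval of the time mesh, $\tau_n=t_n-t_{n-1}>0$. $(\cdot,\cdot)$ is the Euclidean inner product on $\mathbb R^d$. $P_s(J,\mathbb R^q)$ is the space of $\mathbb R^q$-valued polynomials on $J$ of degree $\le s$. Values and derivatives at $t_{n-1}^+$ and $t_n^-$ are one-sided, taken from $I_n$; the value at $t_{n-1}^-$ is the prescribed one, inherited from the previous subinterval (or $u_0$ if $n=1$). $[U]_{n-1}=U(t_{n-1}^+)-U(t_{n-1}^-)$; $\delta_{i,j}$ is the Kronecker delta. Interpolation and quadrature: for $0\le k\le r$ let $\widehat{\mathcal I}^r_k:C^{\lfloor k/2\rfloor}([-1,1])\to P_r([-1,1])$ be the Hermite interpolation operator preserving derivatives of orders $0,\dots,\lfloor\frac{k-1}{2}\rfloor$ at $-1$ (none if $k=0$), derivatives of orders $0,\dots,\lfloor\frac k2\rfloor$ at $+1$, and the function values at the zeros $\hat t_1,\dots,\hat t_{r-k}\in(-1,1)$ of the $(r-k)$th Jacobi polynomial with respect to the weight $(1+\hat t)^{\lfloor\frac{k-1}{2}\rfloor+1}(1-\hat t)^{\lfloor\frac k2\rfloor+1}$. Let $\widehat Q^r_k[\hat f]=\int_{-1}^1\widehat{\mathcal I}^r_k\hat f\,\mathrm d\hat t$;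 $\mathcal I^r_k$ (applied componentwise) and $Q^r_k$ denote their affine transformations to $I_n$ (so $Q^r_k[\varphi]=\int_{I_n}\mathcal I^r_k\varphi\,\mathrm dt$), and $t_{n,i}=\frac12(t_{n-1}+t_n+\tau_n\hat t_i)$, $i=1,\dots,r-k$. Local problem of $Q^r_k\text{-}\mathbf{VTD}^r_k$: given $U(t_{n-1}^-)$, find $U\in P_r(I_n,\mathbb R^d)$ such that (1) if $k\ge1$: $U(t_{n-1}^+)=U(t_{n-1}^-)$; (2) if $k\ge2$: $M U^{(i+1)}(t_n^-)=\frac{\mathrm d^i}{\mathrm dt^i}\big(F(t,U(t))\big)\big|_{t=t_n^-}$ for $i=0,\dots,\lfloor\frac k2\rfloor-1$; (3) if $k\ge3$: $M U^{(i+1)}(t_{n-1}^+)=\frac{\mathrm d^i}{\mathrm dt^i}\big(F(t,U(t))\big)\big|_{t=t_{n-1}^+}$ for $i=0,\dots,\lfloor\frac{k-1}2\rfloor-1$; (4) $Q^r_k\big[(MU',\varphi)\big]+\delta_{0,k}\big(M[U]_{n-1},\varphi(t_{n-1}^+)\big)=Q^r_k\big[(F(\cdot,U(\cdot)),\varphi)\big]$ for all $\varphi\in P_{r-k}(I_n,\mathbb R^d)$. *)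

(* Defs.v *)
From HB Require Import structures.
From mathcomp Require Import all_boot all_order all_algebra.
From mathcomp Require Import all_classical all_reals all_analysis.

Set Implicit Arguments.
Unset Strict Implicit.
Unset Printing Implicit Defensive.

Import Order.TTheory GRing.Theory Num.Theory.
Import numFieldNormedType.Exports.

Local Open Scope classical_set_scope.
Local Open Scope ring_scope.

(** Derivatives relative to a set: increments h are restricted to x + h \in A,
    so that at an end point of an interval the derivative is one-sided. *)

Definition quotient_within (R : realType) (V : normedModType R) (A : set R)
    (f : R -> V) (x : R) : set_system V :=
  (fun h : R => h^-1 *: (f (x + h) - f x)) @ within [set h | A (x + h)] 0^'.

Definition derivable_within (R : realType) (V : normedModType R) (A : set R)
    (f : R -> V) (x : R) : Prop :=
  cvg (quotient_within A f x).

Definition derive_within (R : realType) (V : normedModType R) (A : set R)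
    (f : R -> V) (x : R) : V :=
  lim (quotient_within A f x).

Definition deriven_within (R : realType) (V : normedModType R) (A : set R)
    (i : nat) (f : R -> V) : R -> V :=
  iter i (derive_within A) f.

(** [Cn_on A m G]: all partial derivatives of G of total order <= m exist and
    are continuous on A x R^d (those in t being relative to A). *)
Fixpoint Cn_on (R : realType) (d : nat) (A : set R) (m : nat)
    (G : R -> 'cV[R]_d -> 'cV[R]_d) : Prop :=
  {within A `*` setT, continuous (fun z : R * 'cV[R]_d => G z.1 z.2)} /\
  if m is m'.+1 then
    [/\ forall t u, A t -> derivable_within A (G ^~ u) t,
        Cn_on A m' (fun t u => derive_within A (G ^~ u) t),
        forall (j : 'I_d) t u, A t -> derivable (G t) u (delta_mx j 0) &
        forall j : 'I_d, Cn_on A m' (fun t u => 'D_(delta_mx j 0) (G t) u)]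
  else True.

(** Euclidean inner product of R^d. *)
Definition inner (R : realType) (d : nat) (u v : 'cV[R]_d) : R :=
  \sum_(i < d) u i 0 * v i 0.

(** R^d-valued polynomials are column vectors of polynomials. *)

Definition vpoly_le (R : realType) (d s : nat) (U : 'cV[{poly R}]_d) : Prop :=
  forall j, (size (U j 0%R) <= s.+1)%N.

Definition vhorner (R : realType) (d : nat) (U : 'cV[{poly R}]_d) (t : R)
    : 'cV[R]_d :=
  \col_j (U j 0).[t].

Definition vderivn (R : realType) (d : nat) (U : 'cV[{poly R}]_d) (i : nat)
    : 'cV[{poly R}]_d :=
  \col_j (U j 0)^`(i).

(** The monic orthogonal polynomial of degree m on [-1, 1] for the weight
    (1 - x)^alpha (1 + x)^beta; the normalisation does not affect its zeros. *)
Definition jacobi (R : realType) (m alpha beta : nat) : {poly R} :=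
  xget 0 [set J : {poly R} |
    [/\ J \is monic, size J = m.+1 &
      forall q : {poly R}, (size q <= m)%N ->
        \int[lebesgue_measure]_(x in `[-1, 1])
          ((1 - x) ^+ alpha * (1 + x) ^+ beta * J.[x] * q.[x]) = 0]].

(** The set of the zeros of the (r-k)-th Jacobi polynomial for the weight
    (1 + x)^(floor((k-1)/2)+1) (1 - x)^(floor(k/2)+1).
    For every k, including k = 0, uphalf k = floor((k-1)/2) + 1. *)
Definition jacobi_nodes (R : realType) (r k : nat) : set R :=
  [set x | root (jacobi R (r - k) k./2.+1 (uphalf k)) x].

(** The Hermite interpolation operator on [-1, 1]; the condition
    [i < uphalf k] reads i <= floor((k-1)/2), and is void for k = 0. *)
Definition hermite_ref (R : realType) (r k : nat) (f : R -> R) : {poly R} :=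
  let D i := deriven_within `[-1, 1] i f in
  xget 0 [set p : {poly R} |
    [/\ (size p <= r.+1)%N,
        forall i, (i < uphalf k)%N -> p^`(i).[-1] = D i (-1),
        forall i, (i <= k./2)%N -> p^`(i).[1] = D i 1 &
        forall x, jacobi_nodes r k x -> p.[x] = f x]].

(** Affine map of [-1, 1] onto [a, b], and its inverse as a polynomial. *)
Definition aff (R : realType) (a b x : R) : R := (a + b + (b - a) * x) / 2.

Definition aff_inv (R : realType) (a b : R) : {poly R} :=
  (b - a)^-1 *: (2 *: 'X - (a + b)%:P).

Definition hermite (R : realType) (r k : nat) (a b : R) (f : R -> R)
    : {poly R} :=
  hermite_ref r k (f \o aff a b) \Po aff_inv a b.

Definition vhermite (R : realType) (d r k : nat) (a b : R)
    (f : R -> 'cV[R]_d) : 'cV[{poly R}]_d :=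
  \col_j hermite r k a b (fun t => f t j 0).

Definition quad (R : realType) (r k : nat) (a b : R) (f : R -> R) : R :=
  \int[lebesgue_measure]_(t in `]a, b]) (hermite r k a b f).[t].

(** U \in P_r solves the local problem of Q^r_k-VTD^r_k on ]a, b], where
    uprev is the given value at a^-. *)
Definition vtd_solution (R : realType) (d : nat) (M : 'M[R]_d)
    (F : R -> 'cV[R]_d -> 'cV[R]_d) (a b : R) (uprev : 'cV[R]_d) (r k : nat)
    (U : 'cV[{poly R}]_d) : Prop :=
  let FU t := F t (vhorner U t) in
  let D i := deriven_within `[a, b] i FU in
  [/\ vpoly_le r U,
      (1 <= k)%N -> vhorner U a = uprev,
      (2 <= k)%N -> forall i, (i < k./2)%N ->
        M *m vhorner (vderivn U i.+1) b = D i b,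
      (3 <= k)%N -> forall i, (i < k.-1./2)%N ->
        M *m vhorner (vderivn U i.+1) a = D i a &
      forall phi : 'cV[{poly R}]_d, vpoly_le (r - k) phi ->
        quad r k a b
          (fun t => inner (M *m vhorner (vderivn U 1) t) (vhorner phi t))
        + (k == 0)%:R * inner (M *m (vhorner U a - uprev)) (vhorner phi a)
        = quad r k a b (fun t => inner (FU t) (vhorner phi t))].

(** W \in P_(r+1) solves the local collocation problem with multiple nodes. *)
Definition collocation_solution (R : realType) (d : nat) (M : 'M[R]_d)
    (F : R -> 'cV[R]_d -> 'cV[R]_d) (a b : R) (uprev : 'cV[R]_d) (r k : nat)
    (W : 'cV[{poly R}]_d) : Prop :=
  let FW t := F t (vhorner W t) in
  let D i := deriven_within `[a, b] i FW in
  [/\ vpoly_le r.+1 W,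
      vhorner W a = uprev,
      forall i, (i <= k./2)%N ->
        M *m vhorner (vderivn W i.+1) b = D i b,
      (1 <= k)%N -> forall i, (i <= k.-1./2)%N ->
        M *m vhorner (vderivn W i.+1) a = D i a &
      forall x, jacobi_nodes r k x ->
        M *m vhorner (vderivn W 1) (aff a b x) = FW (aff a b x)].

(* Main.v *)
Require Import Defs.
From mathcomp Require Import all_boot all_order all_algebra.
From mathcomp Require Import all_classical all_reals all_analysis.
From mathcomp Require Import ring lra zify polyrcf.
Import Order.TTheory GRing.Theory Num.Theory.
Import numFieldNormedType.Exports.
Local Open Scope classical_set_scope.
Local Open Scope ring_scope.

(** Let omega be the monic polynomial of degree r + 1 that vanishes to order
    floor((k-1)/2) + 1 at a (order 0 if k = 0), to order floor(k/2) + 1 at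
    b, and at the r - k inner nodes. Hermite interpolation of a polynomial is
    reduction modulo omega ([hermiteE]), and since omega is a Jacobi polynomial
    times its weight it is orthogonal to all polynomials of degree < r - k
    ([node_poly_orthogonal]), so the quadrature is exact up to degree 2 r - k
    ([quad_exact]). Consequently W and its interpolant U differ by c omega with c
    a constant vector.

    The correspondence rests on two facts about such a pair. Firstly, U and W
    have the same Hermite data, hence so do F(., U) and F(., W): by the chain
    rule the derivatives of t |-> F(t, U(t)) at a point depend only on those of U
    ([contact_comp]). Secondly, integrating by parts, (M c omega', phi) integrates
    to zero for every test polynomial phi, up to the boundary term at a, which
    survives only for k = 0 and is then the jump term of the variational equation
    ([intp_mass_deriv]).

    If W solves the collocation problem, F(., U) has the data of M W', so testing
    it amounts to testing M W', hence M U' plus the jump term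
    ([collocation_vtd]). Conversely, for a variational solution U choose c so that
    W = U + c omega takes the initial value and satisfies the collocation equation
    of highest order at b ([correction]). The residual of W, interpolated in
    P_r, is orthogonal to P_(r-k) and has k zeros at the ends, so it is
    v s with v of one sign and s in P_(r-k); testing with s gives s = 0
    ([residual_eq0]). Every variational solution is thus the interpolant of a
    collocation solution ([vtd_collocation]), which yields uniqueness.

    Existence of the Jacobi polynomial and simplicity of its zeros in ]-1, 1[
    are proved by orthogonal projection ([jacobiP]) and by counting sign changes
    ([orthogonal_roots]). *)

(** * Integrals of polynomials *)

Section PolynomialIntegral.
Context {R : realType}.
Implicit Types (p q : {poly R}) (a b c : R).

(** At i = 0 the coefficient is p_0 / 0 = 0, the constant of integration. *)
Definition primitive p : {poly R} :=
  \poly_(i < (size p).+1) (p`_i.-1 / i%:R).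

Lemma primitiveK p : (primitive p)^`() = p.
Proof.
apply/polyP => i; rewrite coef_deriv coef_poly ltnS /=.
case: ltnP => [_|le_pi]; last by rewrite mul0rn nth_default.
by rewrite -[LHS]mulr_natr divfK // pnatr_eq0.
Qed.

Lemma deriv_eq0 p : p^`() = 0 -> p = (p`_0)%:P.
Proof.
move=> p'0; apply/polyP => -[|i]; rewrite coefC //=.
have := congr1 (fun q : {poly R} => q`_i) p'0.
by rewrite coef_deriv coef0 => /eqP; rewrite mulrn_eq0 => /eqP.
Qed.

(** The Lebesgue integral of a polynomial over [a, b], in a form on which
    linearity, substitution and integration by parts are algebraic. *)
Definition intp a b p : R := (primitive p).[b] - (primitive p).[a].

Lemma intp_deriv a b p : intp a b p^`() = p.[b] - p.[a].
Proof.
have /deriv_eq0 E : (primitive p^`() - p)^`() = 0.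
  by rewrite derivB primitiveK subrr.
rewrite /intp -[primitive _](subrK p) E !hornerD !hornerC; ring.
Qed.

Lemma intpD a b p q : intp a b (p + q) = intp a b p + intp a b q.
Proof.
rewrite -{1}[p]primitiveK -{1}[q]primitiveK -derivD intp_deriv !hornerD.
rewrite /intp; ring.
Qed.

Lemma intpZ a b c p : intp a b (c *: p) = c * intp a b p.
Proof.
by rewrite -{1}[p]primitiveK -derivZ intp_deriv !hornerZ mulrBr.
Qed.

Lemma intpB a b p q : intp a b (p - q) = intp a b p - intp a b q.
Proof. by rewrite -scaleN1r intpD intpZ mulN1r. Qed.

Lemma intp0 a b : intp a b 0 = 0.
Proof. by rewrite -(scale0r 0) intpZ mul0r. Qed.

Lemma intp_sum a b (I : Type) (s : seq I) (P : I -> {poly R}) :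
  intp a b (\sum_(i <- s) P i) = \sum_(i <- s) intp a b (P i).
Proof. by apply: (big_morph (intp a b)); [exact: intpD | exact: intp0]. Qed.

Lemma intp_comp a b c p q : q^`() = c%:P ->
  c * intp a b (p \Po q) = intp q.[a] q.[b] p.
Proof.
move=> q'; rewrite -intpZ.
have -> : c *: (p \Po q) = ((primitive p) \Po q)^`().
  by rewrite deriv_comp primitiveK q' mulrC mul_polyC.
by rewrite intp_deriv !horner_comp.
Qed.

Lemma poly_eq0_itv a b p : a < b ->
  (forall x, a <= x <= b -> p.[x] = 0) -> p = 0.
Proof.
move=> ab p0; apply: (@roots_geq_poly_eq0 _ p
  [seq a + (b - a) / i.+1%:R | i <- iota 0 (size p)]).
- apply/allP => x /mapP[i _ ->]; rewrite rootE p0 //.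
  have i0 : (0 : R) < i.+1%:R by rewrite ltr0n.
  have ba : 0 < b - a by rewrite subr_gt0.
  have := divr_gt0 ba i0.
  have : (b - a) / i.+1%:R <= b - a.
    by rewrite ler_pdivrMr // ler_peMr ?ler1n // ltW.
  by move: (_ / _) => t h1 h2; apply/andP; split; lra.
- rewrite map_inj_uniq ?iota_uniq // => i j /addrI /mulfI.
  rewrite subr_eq0 gt_eqF // => /(_ isT) /invr_inj /eqP.
  by rewrite eqr_nat => /eqP [].
- by rewrite size_map size_iota.
Qed.

Lemma horner_ndecr a b p : (forall x, a <= x <= b -> 0 <= (p^`()).[x]) ->
  forall x y, a <= x -> x <= y -> y <= b -> p.[x] <= p.[y].
Proof.
move=> p'0 x y ax xy yb.
apply: (@ger0_derive1_le_cc _ (horner p) a b) => //.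
- move=> z; rewrite in_itv /= => /andP[/ltW az /ltW zb].
  by rewrite -derivE p'0 // az.
- by apply: continuous_subspaceT; exact: continuous_horner.
- by rewrite in_itv /= ax (le_trans xy).
- by rewrite in_itv /= yb (le_trans ax).
Qed.

Lemma intp_ge0 a b p : a <= b ->
  (forall x, a <= x <= b -> 0 <= p.[x]) -> 0 <= intp a b p.
Proof.
move=> ab p0; rewrite subr_ge0.
by apply: (horner_ndecr a b); rewrite ?primitiveK.
Qed.

(** The primitive of p is nondecreasing on [a, b] with equal values at the two
    ends, so it is constant there, and a polynomial constant on an interval is
    constant. *)
Lemma intp_eq0 a b p : a < b ->
  (forall x, a <= x <= b -> 0 <= p.[x]) -> intp a b p = 0 -> p = 0.
Proof.
move=> ab p0 /eqP; rewrite /intp subr_eq0 => /eqP Eab.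
have mono := @horner_ndecr a b (primitive p).
rewrite primitiveK in mono; have {}mono := mono p0.
have : primitive p - ((primitive p).[a])%:P = 0.
  apply: (poly_eq0_itv a b) => // x /andP[ax xb].
  rewrite hornerD hornerN hornerC; apply/eqP; rewrite subr_eq0 eq_le.
  by rewrite (mono a x) // -Eab (mono x b).
move/(congr1 (fun q : {poly R} => q^`())).
by rewrite derivB primitiveK derivC subr0 deriv0.
Qed.

Lemma Rintegral_poly_cc a b p : a < b ->
  \int[lebesgue_measure]_(x in `[a, b]) p.[x] = intp a b p.
Proof.
move=> ab; rewrite /Rintegral.
rewrite (@continuous_FTC2 _ (horner p) (horner (primitive p)) a b ab) //.
- by apply: continuous_subspaceT; exact: continuous_horner.
- split.
  + by move=> x _; exact: derivable_horner.
  + by apply: cvg_at_right_filter; exact: continuous_horner.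
  + by apply: cvg_at_left_filter; exact: continuous_horner.
- by move=> x _; rewrite -derivE primitiveK.
Qed.

Lemma Rintegral_poly_oc a b p : a < b ->
  \int[lebesgue_measure]_(x in `]a, b]) p.[x] = intp a b p.
Proof.
move=> ab; rewrite -Rintegral_poly_cc // Rintegral_itv_obnd_cbnd //.
have itf : lebesgue_measure.-integrable `[a, b] (EFin \o horner p).
  apply: continuous_compact_integrable => //; first exact: segment_compact.
  by apply: continuous_subspaceT; exact: continuous_horner.
apply: integrableS itf => //.
by apply: subset_itvr; rewrite bnd_simp.
Qed.

End PolynomialIntegral.

(** * Jacobi polynomials and their zeros *)

Section OrthogonalPolynomial.
Context {R : realType}.
Implicit Types (p q w : {poly R}) (a b : R).

Lemma intp_sqr_eq0 a b w q : a < b -> w != 0 ->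
  (forall x, a <= x <= b -> 0 <= w.[x]) -> intp a b (w * q * q) = 0 -> q = 0.
Proof.
move=> ab w0 wge0 /(intp_eq0 _ _ _ ab).
have pos x : a <= x <= b -> 0 <= (w * q * q).[x].
  by move=> xab; rewrite !hornerM -mulrA mulr_ge0 ?wge0 // -expr2 sqr_ge0.
by move=> /(_ pos)/eqP; rewrite !mulf_eq0 (negPf w0) orbb => /eqP.
Qed.

(** Orthogonal projection, built by adjoining to the projection onto degree
    < n the component along the orthogonal polynomial of degree n. *)
Lemma orthogonal_projection a b w n p : a < b -> w != 0 ->
  (forall x, a <= x <= b -> 0 <= w.[x]) ->
  exists2 q : {poly R}, (size q <= n)%N &
    forall s : {poly R}, (size s <= n)%N -> intp a b (w * (p - q) * s) = 0.
Proof.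
move=> ab w0 wge0; elim: n p => [|n IH] p.
  exists 0; rewrite ?size_poly0 // => s; rewrite leqn0 size_poly_eq0 => /eqP ->.
  by rewrite mulr0 intp0.
have [q sq oq] := IH p; have [q1 sq1 oq1] := IH 'X^n.
pose J := 'X^n - q1; rewrite -/J in oq1.
have Jn : J`_n = 1 by rewrite coefB coefXn eqxx (nth_default _ sq1) subr0.
have sJ : (size J <= n.+1)%N.
  by rewrite (leq_trans (size_polyD _ _)) // size_polyN size_polyXn geq_max
    leqnn ltnW.
have JJ : intp a b (w * J * J) != 0.
  apply: contraNneq (oner_neq0 R) => /(intp_sqr_eq0 _ _ _ _ ab w0 wge0) J0.
  by rewrite -Jn J0 coef0.
pose c := intp a b (w * (p - q) * J) / intp a b (w * J * J).
exists (q + c *: J).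
  rewrite (leq_trans (size_polyD _ _)) // geq_max (leq_trans sq) //=.
  exact: leq_trans (size_scale_leq _ _) sJ.
move=> s ss; pose s0 := s - s`_n *: J.
have ss0 : (size s0 <= n)%N.
  apply/leq_sizeP => j; rewrite leq_eqVlt => /predU1P[<-|nj].
    by rewrite coefB coefZ Jn mulr1 subrr.
  rewrite coefB coefZ (nth_default _ (leq_trans ss nj)).
  by rewrite (nth_default _ (leq_trans sJ nj)) mulr0 subr0.
have -> : s = s`_n *: J + s0 by rewrite addrC subrK.
have -> : w * (p - (q + c *: J)) * (s`_n *: J + s0) =
  s`_n *: (w * (p - q) * J - c *: (w * J * J)) +
  (w * (p - q) * s0 - c *: (w * J * s0)).
  by rewrite -!mul_polyC; ring.
rewrite intpD intpZ !intpB !intpZ (oq _ ss0) (oq1 _ ss0) mulr0 /c divfK //.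
by rewrite !subrr mulr0 addr0.
Qed.

(** By the intermediate value theorem, opposite signs would give a root strictly
    between, hence in the open interval. *)
Lemma poly_const_sign a b p :
  (forall x, a < x < b -> ~~ root p x) ->
  (forall x, a <= x <= b -> 0 <= p.[x]) \/
  (forall x, a <= x <= b -> p.[x] <= 0).
Proof.
move=> nr; case: (pselect (exists2 x, a <= x <= b & p.[x] < 0)); last first.
  move=> nx; left => x xab; rewrite leNgt; apply/negP => px.
  by apply: nx; exists x.
move=> [x /andP[ax xb] px]; right => y /andP[ay yb].
rewrite leNgt; apply/negP => py.
have [xy|yx] := leP x y.
  have [|z zxy] := @poly_ivtoo _ p x y xy; first by rewrite nmulr_rlt0.
  apply/negP; apply: nr; move: zxy; rewrite in_itv /= => /andP[xz zy].
  by rewrite (le_lt_trans ax) // (lt_le_trans zy).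
have [|z zxy] := @poly_ivtoo _ p y x (ltW yx); first by rewrite pmulr_rlt0.
apply/negP; apply: nr; move: zxy; rewrite in_itv /= => /andP[xz zy].
by rewrite (le_lt_trans ay) // (lt_le_trans zy).
Qed.

(** The points zs are the roots of odd multiplicity of p in ]a, b[: dividing p
    by X - z toggles the membership of z in that list, which gives an induction
    on the degree without mentioning multiplicities. *)
Lemma sign_changes a b p : p != 0 ->
  exists zs : seq R, [/\ uniq zs, all (fun z => a < z < b) zs,
    \prod_(z <- zs) ('X - z%:P) %| p &
    (forall x, a <= x <= b -> 0 <= (p * \prod_(z <- zs) ('X - z%:P)).[x]) \/
    (forall x, a <= x <= b -> (p * \prod_(z <- zs) ('X - z%:P)).[x] <= 0)].
Proof.
have [n] := ubnP (size p); elim: n p => // n IH p sp p0.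
case: (pselect (exists2 z, a < z < b & root p z)); last first.
  move=> nz; exists [::]; rewrite big_nil mulr1 dvd1p; split => //.
  by apply: poly_const_sign => x xab; apply/negP => rx; apply: nz; exists x.
move=> [z zab /factor_theorem[p1 Ep]].
have p1_0 : p1 != 0 by apply: contraNneq p0 => p10; rewrite Ep p10 mul0r.
have [|zs [uzs azs dzs sgn]] := IH p1 _ p1_0.
  by move: sp; rewrite Ep size_Mmonic ?monicXsubC // size_XsubC addn2.
have [zzs|zzs] := boolP (z \in zs).
  have Ezs : \prod_(y <- zs) ('X - y%:P) =
    ('X - z%:P) * \prod_(y <- rem z zs) ('X - y%:P) by rewrite (big_rem z zzs).
  exists (rem z zs); split.
  - exact: rem_uniq.
  - by apply/allP => y /mem_rem; apply: (allP azs).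
  - rewrite Ep; apply: dvdp_mulr; apply: dvdp_trans dzs.
    by rewrite Ezs dvdp_mull.
  - by rewrite Ep -mulrA -Ezs.
exists (z :: zs); rewrite /= zzs uzs zab azs big_cons; split => //.
  by rewrite Ep mulrC dvdp_mul.
rewrite Ep.
have E x : (p1 * ('X - z%:P) * (('X - z%:P) * \prod_(j <- zs) ('X - j%:P))).[x]
  = (x - z) ^+ 2 * (p1 * \prod_(j <- zs) ('X - j%:P)).[x].
  by rewrite !hornerM hornerXsubC; ring.
by case: sgn => sgn; [left|right] => x xab; rewrite E;
  [apply: mulr_ge0|apply: mulr_ge0_le0]; rewrite ?sqr_ge0 ?sgn.
Qed.

(** If J had fewer than n sign changes in ]a, b[, the product of the X - z over
    them would have degree < n, and its product with J would keep its sign on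
    [a, b], contradicting orthogonality. *)
Lemma orthogonal_roots a b w n (J : {poly R}) : a < b -> w != 0 ->
  (forall x, a <= x <= b -> 0 <= w.[x]) -> J \is monic -> size J = n.+1 ->
  (forall q : {poly R}, (size q <= n)%N -> intp a b (w * J * q) = 0) ->
  exists zs : seq R, [/\ uniq zs, all (fun z => a < z < b) zs, size zs = n &
    J = \prod_(z <- zs) ('X - z%:P)].
Proof.
move=> ab w0 wge0 Jm sJ oJ.
have [zs [uzs azs dzs sgn]] := @sign_changes a b J (monic_neq0 Jm).
set q := \prod_(z <- zs) _ in dzs sgn.
have q0 : q != 0 by rewrite monic_neq0 // monic_prod_XsubC.
have sq : size q = (size zs).+1 by rewrite size_prod_XsubC.
have szs : size zs = n.
  apply/eqP; rewrite eqn_leq; have := dvdp_leq (monic_neq0 Jm) dzs.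
  rewrite sq sJ ltnS => -> /=; rewrite leqNgt -sq; apply/negP => /oJ I0.
  suff : w * J * q = 0.
    by apply/eqP; rewrite !mulf_neq0 // monic_neq0.
  case: sgn => sgn.
    by apply: (intp_eq0 _ _ _ ab) => // x xab; rewrite -mulrA hornerM
      mulr_ge0 ?wge0 ?sgn.
  apply/eqP; rewrite -oppr_eq0; apply/eqP.
  apply: (intp_eq0 _ _ _ ab) => [x xab|].
    by rewrite hornerN oppr_ge0 -mulrA hornerM mulr_ge0_le0 ?wge0 ?sgn.
  by rewrite -sub0r intpB intp0 I0 subr0.
exists zs; split => //.
rewrite {1}(@all_roots_prod_XsubC _ J zs).
- by rewrite (monicP Jm) scale1r.
- by rewrite sJ szs.
- apply/allP => z zzs; rewrite -dvdp_XsubCl; apply: dvdp_trans dzs.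
  by rewrite dvdp_XsubCl root_prod_XsubC.
- by rewrite uniq_rootsE.
Qed.

Definition jacobi_weight (alpha beta : nat) : {poly R} :=
  (1 - 'X) ^+ alpha * (1 + 'X) ^+ beta.

Lemma jacobi_weight_neq0 alpha beta : jacobi_weight alpha beta != 0.
Proof.
have lin (s : R) : s != 0 -> 1 + s *: 'X != 0 :> {poly R}.
  move=> s0; apply: contraNneq s0 => /(congr1 (fun p : {poly R} => p`_1)).
  by rewrite coefD coefZ coefX coef1 coef0 mulr1 add0r => ->.
rewrite /jacobi_weight mulf_neq0 // expf_neq0 //.
  by rewrite -scaleN1r lin // oppr_eq0 oner_eq0.
by rewrite -['X]scale1r lin // oner_eq0.
Qed.

Lemma jacobi_weight_ge0 alpha beta x :
  -1 <= x <= 1 -> 0 <= (jacobi_weight alpha beta).[x].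
Proof.
move=> /andP[x0 x1]; rewrite /jacobi_weight !hornerE.
by rewrite mulr_ge0 // exprn_ge0 //; lra.
Qed.

(** X^n minus its orthogonal projection onto degree < n witnesses the existence
    of the polynomial that the definition selects. *)
Lemma jacobiP n alpha beta : let J := jacobi R n alpha beta in
  [/\ J \is monic, size J = n.+1 & forall q : {poly R}, (size q <= n)%N ->
    intp (-1) 1 (jacobi_weight alpha beta * J * q) = 0].
Proof.
have N11 : -1 < 1 :> R by lra.
set P := [set J : {poly R} | [/\ J \is monic, size J = n.+1 &
  forall q : {poly R}, (size q <= n)%N -> \int[lebesgue_measure]_(x in `[-1, 1])
    ((1 - x) ^+ alpha * (1 + x) ^+ beta * J.[x] * q.[x]) = 0]].
have RI J q : \int[lebesgue_measure]_(x in `[-1, 1])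
    ((1 - x) ^+ alpha * (1 + x) ^+ beta * J.[x] * q.[x]) =
    intp (-1) 1 (jacobi_weight alpha beta * J * q).
  rewrite -Rintegral_poly_cc //; apply: eq_Rintegral => x _.
  by rewrite /jacobi_weight !hornerE.
suff [Jm sJ oJ] : P (jacobi R n alpha beta).
  by split => // q sq; rewrite -RI oJ.
apply: xgetPex.
have [q sq oq] := @orthogonal_projection _ _ _ n 'X^n N11
  (jacobi_weight_neq0 alpha beta) (jacobi_weight_ge0 alpha beta).
have sXq : size ('X^n - q) = n.+1.
  by rewrite size_polyDl size_polyXn // size_polyN ltnS.
exists ('X^n - q); split => // [|s ss].
  rewrite monicE lead_coefE sXq coefB coefXn eqxx.
  by rewrite (nth_default _ sq) subr0.
by rewrite RI oq.
Qed.

End OrthogonalPolynomial.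

(** * Hermite interpolation at multiple nodes *)

Section HermiteInterpolation.
Context {R : realType}.
Implicit Types (p q N : {poly R}) (a b c : R).

(** For the converse, write p = s (X - c)^(n+1) by induction: as (X - c)^(n+1)
    also divides p', X - c divides (n + 1) s, hence s, in characteristic 0. *)
Lemma dvdp_XsubC_expP p c n :
  reflect (forall i, (i < n)%N -> p^`(i).[c] = 0) (('X - c%:P) ^+ n %| p).
Proof.
elim: n p => [|n IH] p; first by rewrite expr0 dvd1p; left.
apply: (iffP idP) => [dv [_|i]|p0].
- apply/rootP; rewrite -dvdp_XsubCl; apply: dvdp_trans dv.
  by rewrite exprS dvdp_mulr.
- rewrite ltnS derivSn; move: i; apply/IH.
  have [q ->] := dvdpP _ _ dv.
  rewrite derivM deriv_exp derivXsubC mul1r /= dvdp_add //.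
    by rewrite exprS mulrA dvdp_mull.
  by rewrite -scaler_nat dvdp_mull // dvdpZr // pnatr_eq0.
- have /dvdpP[s Es] : ('X - c%:P) ^+ n %| p.
    by apply/IH => i ni; apply: p0; rewrite ltnW.
  case: n => [|n] in IH p0 Es *.
    by rewrite expr1 dvdp_XsubCl; apply/rootP/(p0 0).
  have : ('X - c%:P) ^+ n.+1 %| p^`().
    by apply/IH => i ni; rewrite -derivSn p0.
  rewrite Es derivM deriv_exp derivXsubC mul1r /= dvdp_addr; last first.
    exact: dvdp_mull.
  rewrite -scaler_nat exprSr [_ ^+ n * _]mulrC -scalerAr dvdpZr ?pnatr_eq0 //.
  rewrite dvdp_mul2r ?expf_neq0 ?polyXsubC_eq0 // => dvs.
  by rewrite -exprS exprS dvdp_mul.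
Qed.

Lemma derivn_eq_dvdP p q c n :
  (forall i, (i < n)%N -> p^`(i).[c] = q^`(i).[c]) <->
  ('X - c%:P) ^+ n %| p - q.
Proof.
split=> [E|/dvdp_XsubC_expP E i ni].
  by apply/dvdp_XsubC_expP => i ni; rewrite derivnB hornerD hornerN E ?subrr.
by have /eqP := E i ni; rewrite derivnB hornerD hornerN subr_eq0 => /eqP.
Qed.

Lemma derivn_XsubC_exp_neq0 c i q : q.[c] != 0 ->
  (q * ('X - c%:P) ^+ i)^`(i).[c] != 0.
Proof.
move=> qc; apply/eqP => E.
have : ('X - c%:P) ^+ i.+1 %| q * ('X - c%:P) ^+ i.
  apply/dvdp_XsubC_expP => j; rewrite ltnS leq_eqVlt => /predU1P[-> //|].
  by move: j; apply/dvdp_XsubC_expP; rewrite dvdp_mull.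
rewrite exprS dvdp_mul2r ?expf_neq0 ?polyXsubC_eq0 // dvdp_XsubCl.
by rewrite rootE (negPf qc).
Qed.

(** Newton's scheme: the data at the new node c are met one order at a time
    by adding multiples of (X - c)^i N. *)
Lemma newton_extend N c n (d : nat -> R) p : N.[c] != 0 ->
  exists2 q : {poly R}, (forall i, (i < n)%N -> q^`(i).[c] = d i) & N %| q - p.
Proof.
move=> Nc; elim: n => [|n [q qd dvq]]; first by exists p; rewrite ?subrr.
pose K := N * ('X - c%:P) ^+ n.
have Kn : K^`(n).[c] != 0 by apply: derivn_XsubC_exp_neq0.
have /dvdp_XsubC_expP K0 : ('X - c%:P) ^+ n %| K by rewrite dvdp_mull.
exists (q + ((d n - q^`(n).[c]) / K^`(n).[c]) *: K).
  move=> i; rewrite ltnS derivnD derivnZ hornerD hornerZ leq_eqVlt.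
  move=> /predU1P[->|ni]; first by rewrite divfK // addrC subrK.
  by rewrite (K0 _ ni) mulr0 addr0 qd.
by rewrite addrAC dvdp_add // -mul_polyC dvdp_mull // dvdp_mulr.
Qed.

(** Zero Hermite data of a polynomial (to order alpha at a, beta at b, and values
    at zs) amounts to divisibility by this product. *)
Definition nodal (alpha beta : nat) a b (zs : seq R) : {poly R} :=
  ('X - a%:P) ^+ alpha * ('X - b%:P) ^+ beta * \prod_(z <- zs) ('X - z%:P).

Section Nodes.
Context (alpha beta : nat) (a b : R) (zs : seq R).
Let om := nodal alpha beta a b zs.

Lemma nodal_monic : om \is monic.
Proof.
by rewrite !monicMr ?monic_exp ?monicXsubC // monic_prod_XsubC.
Qed.

Lemma size_nodal : size om = (alpha + beta + size zs).+1.
Proof.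
rewrite !size_Mmonic ?monic_neq0 ?monicMr ?monic_exp ?monicXsubC
  ?monic_prod_XsubC //.
by rewrite !size_exp_XsubC size_prod_XsubC; lia.
Qed.

Hypotheses (aNb : a != b) (uzs : uniq zs) (azs : a \notin zs) (bzs : b \notin zs).

Lemma ends_nodes_neq0 z : z \in zs ->
  (('X - a%:P) ^+ alpha * ('X - b%:P) ^+ beta).[z] != 0.
Proof.
move=> zzs; rewrite hornerM !horner_exp !hornerXsubC mulf_neq0 // expf_neq0 //.
  by rewrite subr_eq0; apply: contraNneq azs => <-.
by rewrite subr_eq0; apply: contraNneq bzs => <-.
Qed.

Lemma nodal_dvdP p :
  om %| p <->
  [/\ forall i, (i < alpha)%N -> p^`(i).[a] = 0,
      forall i, (i < beta)%N -> p^`(i).[b] = 0 &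
      forall z, z \in zs -> p.[z] = 0].
Proof.
have cab : coprimep (('X - a%:P) ^+ alpha) (('X - b%:P) ^+ beta).
  apply/coprimep_expl/coprimep_expr; rewrite coprimep_XsubC root_XsubC.
  by rewrite eq_sym.
have cz : coprimep (('X - a%:P) ^+ alpha * ('X - b%:P) ^+ beta)
    (\prod_(z <- zs) ('X - z%:P)).
  rewrite big_seq; elim/big_ind: _ => [|x y|z zzs].
  - exact: coprimep1.
  - by rewrite coprimepMr => -> ->.
  - by rewrite coprimep_XsubC rootE ends_nodes_neq0.
have zsP : \prod_(z <- zs) ('X - z%:P) %| p <-> forall z, z \in zs -> p.[z] = 0.
  split=> [dv z zzs|p0].
    apply/rootP; rewrite -dvdp_XsubCl; apply: dvdp_trans dv.
    by rewrite dvdp_XsubCl root_prod_XsubC.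
  apply: uniq_roots_dvdp; last by rewrite uniq_rootsE.
  by apply/allP => z /p0 /rootP.
rewrite /om /nodal Gauss_dvdp // Gauss_dvdp //; split.
  by move=> /andP[/andP[/dvdp_XsubC_expP pa /dvdp_XsubC_expP pb] /zsP pz].
move=> [pa pb /zsP ->]; rewrite andbT.
by apply/andP; split; apply/dvdp_XsubC_expP.
Qed.

Lemma hermite_interpolant (da db : nat -> R) (f : R -> R) :
  exists q : {poly R},
  [/\ forall i, (i < alpha)%N -> q^`(i).[a] = da i,
      forall i, (i < beta)%N -> q^`(i).[b] = db i &
      forall z, z \in zs -> q.[z] = f z].
Proof.
have [|qa qad _] := @newton_extend 1 a alpha da 0.
  by rewrite hornerC oner_eq0.
have [|qb qbd dvb] := @newton_extend (('X - a%:P) ^+ alpha) b beta db qa.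
  by rewrite horner_exp hornerXsubC expf_neq0 // subr_eq0 eq_sym.
suff [q qz dvq] : exists2 q : {poly R}, (forall z, z \in zs -> q.[z] = f z) &
    ('X - a%:P) ^+ alpha * ('X - b%:P) ^+ beta %| q - qb.
  exists q; split => // i ni.
    rewrite -qad //; move: i ni; apply/derivn_eq_dvdP.
    rewrite -(subrK qb q) -addrA dvdp_add //.
    by apply: dvdp_trans dvq; rewrite dvdp_mulr.
  rewrite -qbd //; move: i ni; apply/derivn_eq_dvdP.
  by apply: dvdp_trans dvq; rewrite dvdp_mull.
have := ends_nodes_neq0; elim: zs uzs => [_ _|z s IH /=/andP[zs' us] nz].
  by exists qb; rewrite ?subrr.
have [//|y ys|q qs dvq] := IH.
  by apply: nz; rewrite inE ys orbT.
pose N := ('X - a%:P) ^+ alpha * ('X - b%:P) ^+ beta *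
  \prod_(y <- s) ('X - y%:P).
have Nz : N.[z] != 0.
  rewrite hornerM mulf_neq0 ?nz ?mem_head //.
  by rewrite -rootE root_prod_XsubC.
have [q1 q1z dvq1] := @newton_extend N z 1 (fun=> f z) q Nz.
exists q1 => [y|].
  rewrite inE => /predU1P[->|ys]; first exact: (q1z 0).
  rewrite -qs //; apply/eqP; rewrite -subr_eq0 -hornerN -hornerD.
  rewrite -rootE -dvdp_XsubCl; apply: dvdp_trans dvq1.
  by rewrite dvdp_mull // dvdp_XsubCl root_prod_XsubC.
rewrite -(subrK q q1) -addrA dvdp_add //.
by apply: dvdp_trans dvq1; rewrite dvdp_mulr.
Qed.

End Nodes.

End HermiteInterpolation.

(** * Derivatives relative to an interval and contact of functions *)

Lemma cvg_eqfun (T : Type) (U : nbhsType) (F : set_system T) (f g : T -> U)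
    (l : U) : f =1 g -> f @ F --> l -> g @ F --> l.
Proof. by move/eq_cvg => ->. Qed.

Section OneSidedCalculus.
Context {R : realType} (a b : R).
Hypothesis ab : a < b.
Let A : set R := `[a, b].

(** At an end point there remain the increments towards the interior, so limits
    of difference quotients relative to [a, b] are unique. *)
Lemma within_quotient_proper x : A x ->
  ProperFilter (within [set h | A (x + h)] (0 : R)^').
Proof.
rewrite /A /= in_itv /= => /andP[ax xb]; split; last exact: within_filter.
move=> /nbhs_ballP[e /= e0 sub].
wlog [h [h0 he xh]] : / exists h : R, [/\ h != 0, `|h| < e & A (x + h)].
  apply.
  have [xb'|bx] := ltP x b.
    exists (Num.min (e / 2) (b - x)); split.
    - by rewrite gt_eqF // lt_min divr_gt0 //= subr_gt0.
    - rewrite ger0_norm; last by rewrite le_min divr_ge0 ?(ltW e0) //= subr_ge0.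
      by rewrite gt_min ltr_pdivrMr // ltr_pMr // ltr1n.
    - rewrite /A /= in_itv /=; have : 0 < e / 2 by rewrite divr_gt0.
      by move=> e2; rewrite minEle; case: ifP => h; apply/andP; split; lra.
  exists (- Num.min (e / 2) (x - a)); split.
  - by rewrite oppr_eq0 gt_eqF // lt_min divr_gt0 //= subr_gt0 (lt_le_trans ab).
  - rewrite normrN ger0_norm; last first.
      by rewrite le_min divr_ge0 ?(ltW e0) //= subr_ge0.
    by rewrite gt_min ltr_pdivrMr // ltr_pMr // ltr1n.
  - rewrite /A /= in_itv /=; have : 0 < e / 2 by rewrite divr_gt0.
    by move=> e2; rewrite minEle; case: ifP => h; apply/andP; split; lra.
have : ball 0 e h by rewrite -ball_normE /= sub0r normrN.
by move=> /sub/(_ h0 xh).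
Qed.

Section Vector.
Context {V : normedModType R}.
Implicit Types (f g : R -> V) (x : R) (l k : V).

Lemma derive_withinE f x l : A x ->
  quotient_within A f x --> l -> derive_within A f x = l.
Proof. by move=> /within_quotient_proper ? fl; exact: cvg_lim. Qed.

Lemma derivable_withinE f x l : quotient_within A f x --> l ->
  derivable_within A f x.
Proof. by move=> fl; apply/cvg_ex; exists l. Qed.

Lemma quotient_within_ext f g x l : A x -> (forall y, A y -> f y = g y) ->
  quotient_within A f x --> l -> quotient_within A g x --> l.
Proof.
move=> Ax fg; apply: cvg_trans; apply: near_eq_cvg.
rewrite near_withinE; apply: nearW => h /= Axh.
by rewrite !fg.
Qed.

Lemma derive_within_ext f g x : A x -> derivable_within A f x ->
  (forall y, A y -> f y = g y) -> derive_within A g x = derive_within A f x.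
Proof.
by move=> Ax df fg; apply: derive_withinE => //; apply: quotient_within_ext df.
Qed.

Lemma quotient_withinD f g x l k :
  quotient_within A f x --> l -> quotient_within A g x --> k ->
  quotient_within A (fun t => f t + g t) x --> l + k.
Proof.
move=> fl gk; apply: cvg_eqfun (cvgD fl gk) => h /=.
by rewrite fctE /= -scalerDr addrACA -opprD.
Qed.

Lemma is_derive_quotient_within f (x : R) l :
  is_derive x (1 : R) f l -> quotient_within A f x --> l.
Proof.
move=> [df <-]; have : (fun h => h^-1 *: ((f \o shift x) (h *: 1) - f x))
    @ (0 : R)^' --> 'D_1 f x by exact: df.
move=> /(cvg_within_filter [set h | A (x + h)]).
by apply: cvg_eqfun => h /=; rewrite [h *: _]mulr1 [h + x]addrC.
Qed.

End Vector.

Lemma quotient_within_polyZ {V : normedModType R} (p : {poly R}) (f : R -> V)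
    x l :
  quotient_within A f x --> l ->
  quotient_within A (fun t => p.[t] *: f t) x -->
    p^`().[x] *: f x + p.[x] *: l.
Proof.
move=> fl.
have pc : (fun h => p.[x + h]) @ within [set h | A (x + h)] (0 : R)^'
    --> p.[x].
  apply: cvg_within_filter.
  have xh : (fun h : R => x + h) @ (0 : R)^' --> x.
    rewrite -{2}[x]addr0.
    by apply: (@cvgD _ _ _ _ _ (cst x) id); [exact: cvg_cst|exact: cvg_within].
  exact: (cvg_comp _ _ xh (@continuous_horner _ p x)).
have pd : (fun h => h^-1 *: (p.[x + h] - p.[x])) @
    within [set h | A (x + h)] (0 : R)^' --> p^`().[x].
  exact: (is_derive_quotient_within (horner p) _ _ (is_derive_poly p x)).
apply: cvg_eqfun (cvgD (cvgZ pd (cvg_cst (f x))) (cvgZ pc fl)) => h /=.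
rewrite fctE /= -[h^-1 *: (p.[_] - _)]/(h^-1 * _) -scalerA [p.[x + h] *: (h^-1 *: _)]scalerA.
rewrite [p.[x + h] * _]mulrC -scalerA -scalerDr scalerBl scalerBr.
by rewrite addrC addrA subrK.
Qed.

Lemma quotient_within_coord d (f : R -> 'cV[R]_d) (x : R) (l : 'cV[R]_d) i :
  quotient_within A f x --> l ->
  quotient_within A (fun t => f t i 0) x --> l i 0.
Proof.
move=> fl.
apply: cvg_eqfun (cvg_comp _ _ fl (@coord_continuous _ _ _ i 0 l)) => h /=.
by rewrite !mxE.
Qed.

Definition smooth {V : normedModType R} m (f : R -> V) :=
  forall i, (i < m)%N -> forall y, A y ->
    derivable_within A (deriven_within A i f) y.

(** Equality of Hermite data at x, bundled with the smoothness that makes the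
    iterated derivatives additive and multiplicative: derivatives are defined
    by limits that need not exist, so equality alone would not be stable under
    sums and products. *)
Definition contact {V : normedModType R} (x : R) n m (f g : R -> V) :=
  [/\ smooth m f, smooth m g & forall i, (i < n)%N ->
    deriven_within A i f x = deriven_within A i g x].

Lemma deriven_withinS {V : normedModType R} i (f : R -> V) :
  deriven_within A i.+1 f = deriven_within A i (derive_within A f).
Proof. by rewrite /deriven_within iterSr. Qed.

Lemma deriven_withinSr {V : normedModType R} i (f : R -> V) :
  deriven_within A i.+1 f = derive_within A (deriven_within A i f).
Proof. by []. Qed.

Lemma smoothS {V : normedModType R} m (f : R -> V) :
  smooth m.+1 f <->
  (forall y, A y -> derivable_within A f y) /\ smooth m (derive_within A f).
Proof.
split=> [sf|[df sf] [|i] im y Ay].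
- split=> [y Ay|i im y Ay]; first exact: (sf 0).
  by rewrite -deriven_withinS; apply: sf.
- exact: df.
- by rewrite deriven_withinS; apply: sf.
Qed.

Lemma contactS {V : normedModType R} x n m (f g : R -> V) :
  contact x n m.+1 f g <->
  [/\ forall y, A y -> derivable_within A f y,
      forall y, A y -> derivable_within A g y,
      ((0 < n)%N -> f x = g x) &
      contact x n.-1 m (derive_within A f) (derive_within A g)].
Proof.
split=> [[/smoothS[df sf] /smoothS[dg sg] E]|[df dg E0 [sf sg E]]].
  split=> //; first exact: E.
  by split=> // i ni; rewrite -!deriven_withinS E // -ltn_predRL.
split; [exact/smoothS|exact/smoothS|move=> [|i] ni; first exact: E0].
by rewrite !deriven_withinS E // ltn_predRL.
Qed.

Lemma contact0 {V : normedModType R} x n (f g : R -> V) : (n <= 1)%N ->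
  contact x n 0 f g <-> ((0 < n)%N -> f x = g x).
Proof.
move=> n1; split=> [[_ _ E]|E]; first exact: E.
by split=> // -[|i] ni; [apply: E | case: n n1 ni {E} => [|[]]].
Qed.

Lemma contact_sym {V : normedModType R} x n m (f g : R -> V) :
  contact x n m f g -> contact x n m g f.
Proof. by move=> [sf sg E]; split=> // i ni; rewrite E. Qed.

Lemma contact_trans {V : normedModType R} x n m (f g h : R -> V) :
  contact x n m f g -> contact x n m g h -> contact x n m f h.
Proof.
by move=> [sf _ E] [_ sh E']; split=> // i ni; rewrite E // E'.
Qed.

Lemma contactW {V : normedModType R} x n n' m m' (f g : R -> V) :
  (n' <= n)%N -> (m' <= m)%N -> contact x n m f g -> contact x n' m' f g.
Proof.
move=> nn mm [sf sg E]; split=> [i im|i im|i ni].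
- by apply: sf; apply: leq_trans mm.
- by apply: sg; apply: leq_trans mm.
- by apply: E; apply: leq_trans nn.
Qed.

Lemma contact_ext {V : normedModType R} x n m (f g f' g' : R -> V) : A x ->
  (n <= m.+1)%N ->
  (forall y, A y -> f y = f' y) -> (forall y, A y -> g y = g' y) ->
  contact x n m f g -> contact x n m f' g'.
Proof.
move=> Ax; elim: m n f g f' g' => [|m IH] n f g f' g' nm ff gg.
  by move=> /contact0 E; apply/contact0 => // n0; rewrite -ff // -gg // E.
move=> /contactS[df dg E0 c]; apply/contactS; split.
- by move=> y Ay; apply: derivable_withinE; apply: quotient_within_ext (df y Ay).
- by move=> y Ay; apply: derivable_withinE; apply: quotient_within_ext (dg y Ay).
- by move=> n0; rewrite -ff // -gg // E0.
- apply: IH c => [|y Ay|y Ay]; first by lia.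
  + by rewrite (derive_within_ext f) //; apply: df.
  + by rewrite (derive_within_ext g) //; apply: dg.
Qed.

Lemma contactD {V : normedModType R} x n m (f g f' g' : R -> V) : A x ->
  (n <= m.+1)%N -> contact x n m f g -> contact x n m f' g' ->
  contact x n m (fun t => f t + f' t) (fun t => g t + g' t).
Proof.
move=> Ax; elim: m n f g f' g' => [|m IH] n f g f' g' nm.
  move=> /contact0 E /contact0 E'; apply/contact0 => // n0.
  by rewrite E // E'.
move=> /contactS[df dg E0 c] /contactS[df' dg' E0' c']; apply/contactS; split.
- move=> y Ay; apply: derivable_withinE.
  by apply: quotient_withinD; [exact: df|exact: df'].
- move=> y Ay; apply: derivable_withinE.
  by apply: quotient_withinD; [exact: dg|exact: dg'].
- by move=> n0; rewrite E0 // E0'.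
- have nm' : (n.-1 <= m.+1)%N by lia.
  apply: contact_ext (IH _ _ _ _ _ nm' c c') => // y Ay; apply/esym.
  + apply: derive_withinE => //.
    by apply: quotient_withinD; [exact: df|exact: df'].
  + apply: derive_withinE => //.
    by apply: quotient_withinD; [exact: dg|exact: dg'].
Qed.

(** By the product rule (p f)' = p' f + p f', where both summands are again of
    this form with one order less. *)
Lemma contact_polyZ {V : normedModType R} x n m (p q : {poly R}) (f g : R -> V) :
  A x -> (n <= m.+1)%N -> (forall i, (i < n)%N -> p^`(i).[x] = q^`(i).[x]) ->
  contact x n m f g ->
  contact x n m (fun t => p.[t] *: f t) (fun t => q.[t] *: g t).
Proof.
move=> Ax; elim: m n p q f g => [|m IH] n p q f g nm pq.
  move=> /contact0 E; apply/contact0 => // n0.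
  by rewrite E // -[p]/(p^`(0)) pq.
move=> c; have nm' : (n.-1 <= m.+1)%N by lia.
have c1 : contact x n.-1 m f g by apply: contactW c; lia.
move/contactS: c => [df dg E0 c]; apply/contactS; split.
- move=> y Ay; apply: derivable_withinE.
  by apply: quotient_within_polyZ; exact: df.
- move=> y Ay; apply: derivable_withinE.
  by apply: quotient_within_polyZ; exact: dg.
- by move=> n0; rewrite E0 // -[p]/(p^`(0)) pq.
- have cp : contact x n.-1 m (fun t => p^`().[t] *: f t)
      (fun t => q^`().[t] *: g t).
    by apply: IH => // i ni; rewrite -!derivSn pq // -ltn_predRL.
  have cf : contact x n.-1 m (fun t => p.[t] *: derive_within A f t)
      (fun t => q.[t] *: derive_within A g t).
    by apply: IH => // i ni; rewrite pq // (leq_trans ni) ?leq_pred.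
  apply: contact_ext (contactD _ _ _ _ _ _ _ Ax nm' cp cf) => // y Ay; apply/esym.
  + by apply: derive_withinE => //; apply: quotient_within_polyZ; exact: df.
  + by apply: derive_withinE => //; apply: quotient_within_polyZ; exact: dg.
Qed.

Lemma contact_cst {V : normedModType R} x n m (v : V) : A x -> (n <= m.+1)%N ->
  contact x n m (fun=> v) (fun=> v).
Proof.
move=> Ax; elim: m n v => [|m IH] n v nm; first exact/contact0.
have D y : A y -> quotient_within A (fun=> v) y --> (0 : V).
  by move=> Ay; apply: is_derive_quotient_within; exact: is_derive_cst.
have nm' : (n.-1 <= m.+1)%N by lia.
apply/contactS; split=> [y Ay|y Ay|//|].
- by apply: derivable_withinE; exact: D.
- by apply: derivable_withinE; exact: D.
- by apply: contact_ext (IH n.-1 0 nm') => // y Ay;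
    apply/esym/derive_withinE => //; exact: D.
Qed.

Lemma contact_poly x n m (p q : {poly R}) : A x -> (n <= m.+1)%N ->
  (forall i, (i < n)%N -> p^`(i).[x] = q^`(i).[x]) ->
  contact x n m (horner p) (horner q).
Proof.
move=> Ax nm pq.
have := contact_polyZ x n m p q (fun=> 1 : R) (fun=> 1 : R) Ax nm pq
  (contact_cst _ _ _ (1 : R) Ax nm).
by apply: contact_ext => // y _; rewrite [_ *: _]mulr1.
Qed.

Lemma deriven_within_poly (p : {poly R}) i x : A x ->
  deriven_within A i (horner p) x = p^`(i).[x].
Proof.
elim: i x => [|i IH] x Ax //; rewrite deriven_withinSr.
apply: derive_withinE => //.
apply: (quotient_within_ext (horner p^`(i))) => // [y Ay|]; first by rewrite IH.
by rewrite derivnS; apply: is_derive_quotient_within; exact: is_derive_poly.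
Qed.

Lemma contact_sum {V : normedModType R} x n m (I : Type) (s : seq I)
    (f g : I -> R -> V) : A x -> (n <= m.+1)%N ->
  (forall i, contact x n m (f i) (g i)) ->
  contact x n m (fun t => \sum_(i <- s) f i t) (fun t => \sum_(i <- s) g i t).
Proof.
move=> Ax nm c; elim: s => [|i s IH].
  by apply: contact_ext (contact_cst x n m (0 : V) Ax nm) => // y _;
    rewrite big_nil.
by apply: contact_ext (contactD _ _ _ _ _ _ _ Ax nm (c i) IH) => // y _;
  rewrite big_cons.
Qed.

Lemma deriven_within_coord d (f : R -> 'cV[R]_d) j m i x : smooth m f ->
  (i <= m)%N -> A x ->
  deriven_within A i (fun t => f t j 0) x = deriven_within A i f x j 0.
Proof.
elim: i x => [|i IH] x sf im Ax //; rewrite !deriven_withinSr.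
have E y : A y -> deriven_within A i f y j 0 =
    deriven_within A i (fun t => f t j 0) y by move=> Ay; rewrite IH // ltnW.
apply: derive_withinE => //; apply: quotient_within_ext E _ => //.
by apply: quotient_within_coord; apply: sf.
Qed.

Lemma contact_coord d (f g : R -> 'cV[R]_d) j n m x : A x -> (n <= m.+1)%N ->
  contact x n m f g -> contact x n m (fun t => f t j 0) (fun t => g t j 0).
Proof.
move=> Ax; elim: m n f g => [|m IH] n f g nm.
  by move=> /contact0 E; apply/contact0 => // n0; rewrite E.
move=> /contactS[df dg E0 c]; apply/contactS; split.
- move=> y Ay; apply: derivable_withinE; apply: quotient_within_coord; exact: df.
- move=> y Ay; apply: derivable_withinE; apply: quotient_within_coord; exact: dg.
- by move=> n0; rewrite E0.
- have nm' : (n.-1 <= m.+1)%N by lia.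
  apply: contact_ext (IH _ _ _ nm' c) => // y Ay;
    apply/esym/derive_withinE => //; apply: quotient_within_coord;
    [exact: df|exact: dg].
Qed.

End OneSidedCalculus.

Section AffineChange.
Context {R : realType} (a b : R).
Hypothesis ab : a < b.

Implicit Type x : R.

Lemma aff_itv x : -1 <= x <= 1 -> a <= aff a b x <= b.
Proof.
move: ab => ltab; rewrite /aff => /andP[x0 x1].
have p0 : 0 <= b - a by lra.
have p1 : 0 <= 1 + x by lra.
have p2 : 0 <= 1 - x by lra.
have q1 := mulr_ge0 p0 p1; have q2 := mulr_ge0 p0 p2.
by rewrite ler_pdivlMr // ler_pdivrMr //; apply/andP; split; lra.
Qed.

Lemma quotient_within_aff {V : normedModType R} (f : R -> V) x l :
  quotient_within `[a, b] f (aff a b x) --> l ->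
  quotient_within `[-1, 1] (f \o aff a b) x --> ((b - a) / 2) *: l.
Proof.
move=> fl; set c := (b - a) / 2.
have c0 : c != 0 by rewrite gt_eqF // divr_gt0 // subr_gt0.
have affD h : aff a b (x + h) = aff a b x + c * h.
  by rewrite /aff /c; field.
have ch : (fun h => c * h) @ within [set h | `[-1, 1]%classic (x + h)] (0 : R)^'
    --> within [set h | `[a, b]%classic (aff a b x + h)] (0 : R)^'.
  move=> P /= [e /= e0 sub]; exists (e / `|c|); first by rewrite /= divr_gt0 ?normr_gt0.
  move=> h /= he h0 xh; apply: sub.
  - move: he; rewrite /= !sub0r !normrN [`|c * h|]normrM.
    by rewrite ltr_pdivlMr ?normr_gt0 // mulrC.
  - by rewrite mulf_neq0.
  - rewrite -affD /= in_itv /=; apply: aff_itv.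
    by move: xh; rewrite /= in_itv.
apply: cvg_eqfun (cvgZ (cvg_cst c) (cvg_comp _ _ ch fl)) => h /=.
by rewrite affD scalerA invfM mulrA divff // mul1r.
Qed.

Lemma contact_aff {V : normedModType R} x n m (f g : R -> V) :
  -1 <= x <= 1 -> (n <= m.+1)%N -> contact a b (aff a b x) n m f g ->
  contact (-1) 1 x n m (f \o aff a b) (g \o aff a b).
Proof.
have N11 : -1 < 1 :> R by lra.
move=> x11; have Ax : `[-1, 1]%classic x by rewrite /= in_itv.
elim: m n f g => [|m IH] n f g nm.
  by move=> /(contact0 _ _ _ _ _ _ nm) E; apply/(contact0 _ _ _ _ _ _ nm) => /E.
move=> /contactS[df dg E0 c]; apply/contactS.
have I y : `[-1, 1]%classic y -> `[a, b]%classic (aff a b y).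
  by rewrite /= !in_itv /=; apply: aff_itv.
split=> [y /I Ay|y /I Ay|//|].
- by apply: derivable_withinE; apply: quotient_within_aff; exact: df.
- by apply: derivable_withinE; apply: quotient_within_aff; exact: dg.
have nm' : (n.-1 <= m.+1)%N by lia.
have := contact_polyZ _ _ N11 x n.-1 m (((b - a) / 2)%:P) (((b - a) / 2)%:P) _ _ Ax nm'
  (fun _ _ => erefl) (IH _ _ _ nm' c).
apply: contact_ext => // y Ay; rewrite hornerC; apply/esym/derive_withinE => //.
- by apply: quotient_within_aff; apply: df; apply: I.
- by apply: quotient_within_aff; apply: dg; apply: I.
Qed.

End AffineChange.

(** * First-order expansion and chain rule at the ends of an interval *)

Section ChainRule.
Context {R : realType}.

Lemma mean_value_estimate (f df : R -> R) (s t c e : R) :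
  (forall y, Num.min s t < y < Num.max s t -> is_derive y (1 : R) f (df y)) ->
  {within `[Num.min s t, Num.max s t], continuous f} ->
  (forall y, Num.min s t < y < Num.max s t -> `|df y - c| <= e) ->
  `|f t - f s - c * (t - s)| <= e * `|t - s|.
Proof.
wlog st : s t / s <= t => [hw|].
  have [st|ts] := orP (le_total s t); first exact: hw.
  rewrite minC maxC => D C E; have := hw t s ts D C E.
  have -> : f t - f s - c * (t - s) = - (f s - f t - c * (s - t)) by ring.
  by rewrite normrN [`|s - t|]distrC.
rewrite (min_idPl st) (max_idPr st) => D C E.
move: st; rewrite le_eqVlt => /predU1P[<-|st].
  by rewrite !subrr mulr0 subrr normr0 mulr0.
have D' y : y \in `]s, t[ -> is_derive y (1 : R) f (df y).
  by rewrite in_itv; exact: D.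
have [y yst ->] := MVT st D' C.
by rewrite -mulrBl normrM ler_wpM2r // E //.
Qed.

(** At interior points the relative derivative is the ordinary one, which is
    what the mean value theorem asks for. *)
Lemma quotient_within_is_derive {V : normedModType R} (a b : R) (f : R -> V) (y : R) l :
  a < y < b -> quotient_within `[a, b] f y --> l -> is_derive y (1 : R) f l.
Proof.
move=> /andP[ay yb] fl.
have L : (fun h => h^-1 *: ((f \o shift y) (h *: 1) - f y)) @ (0 : R)^' --> l.
  have near0 : \forall h \near (0 : R)^', `[a, b]%classic (y + h).
    near=> h; rewrite /= in_itv /=.
    have : `|h| < Num.min (y - a) (b - y).
      near: h; apply: dnbhs0_lt; rewrite lt_min !subr_gt0 ay yb //.
    rewrite lt_min !ltr_norml => /andP[/andP[h1 _] /andP[_ h2]].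
    by apply/andP; split; lra.
  move=> P /fl /= Pfl; apply: filterS2 near0 Pfl => h yh /(_ yh) /=.
  by rewrite [h *: _]mulr1 [h + y]addrC.
apply: DeriveDef; first by apply/cvg_ex; exists l.
exact: cvg_lim L.
Unshelve. all: by end_near.
Qed.

Section FirstOrder.
Context {d : nat} (a b : R).
Hypothesis ab : a < b.
Let A : set R := `[a, b].
Implicit Types (G H : R -> 'cV[R]_d -> 'cV[R]_d) (u v : 'cV[R]_d) (x t : R).

Local Notation jcont G :=
  {within A `*` setT, continuous (fun z : R * 'cV[R]_d => G z.1 z.2)}.

Lemma jcont_eps G x u (e : R) : jcont G -> A x -> 0 < e ->
  exists2 r, 0 < r & forall t v, A t -> `|t - x| < r ->
    (forall j, `|v j 0 - u j 0| < r) ->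
    forall i, `|G t v i 0 - G x u i 0| <= e.
Proof.
move=> /subspace_continuousP cG Ax e0.
have := cG (x, u) (conj Ax I); move=> /cvg_ballP/(_ _ e0).
rewrite near_withinE => /nbhs_ballP[r /= r0 sub].
exists r => // t v At tx vu i.
have /sub/= : ball (x, u) r (t, v).
  split => /=; first by rewrite -ball_normE /= distrC.
  split => // k l; rewrite -ball_normE /= distrC [l]ord1 //; exact: vu.
move=> /(_ (conj At I))[_ /(_ i 0)].
by rewrite -ball_normE /= distrC => /ltW.
Qed.

Lemma jcont_fst G u : jcont G -> {within A, continuous (fun t => G t u)}.
Proof.
move=> /subspace_continuousP cG; apply/subspace_continuousP => x Ax.
move=> P /(cG (x, u) (conj Ax I)) /nbhs_ballP[r /= r0 sub].
apply/nbhs_ballP; exists r => // t tx At.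
apply: (sub (t, u)) => //; split => //=; exact: ballxx.
Qed.


(** Passing from u to v one coordinate at a time reduces the expansion to
    one-dimensional mean value estimates along coordinate segments. *)
Lemma coordinate_estimate G t u v (D : 'I_d -> 'cV[R]_d -> 'cV[R]_d)
    (c : 'I_d -> R) (e : R) (i : 'I_d) :
  (forall j (w : 'cV[R]_d), derivable (G t) w (delta_mx j 0)) ->
  (forall j (w : 'cV[R]_d), D j w = 'D_(delta_mx j 0) (G t) w) ->
  (forall j (w : 'cV[R]_d), (forall k, `|w k 0 - u k 0| <= `|v k 0 - u k 0|) ->
    `|D j w i 0 - c j| <= e) ->
  `|G t v i 0 - G t u i 0 - \sum_j c j * (v j 0 - u j 0)| <=
    e * \sum_j `|v j 0 - u j 0|.
Proof.
move=> dG DE bound.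
pose mix (s : seq 'I_d) : 'cV[R]_d := \col_j (if j \in s then v j 0 else u j 0).
suff S (s : seq 'I_d) : uniq s ->
    `|G t (mix s) i 0 - G t u i 0 - \sum_(j <- s) c j * (v j 0 - u j 0)| <=
    e * \sum_(j <- s) `|v j 0 - u j 0|.
  have := S (enum 'I_d) (enum_uniq _).
  rewrite !big_enum /=; congr (`|G t _ i 0 - _ - _| <= _).
  by apply/colP => j; rewrite mxE mem_enum.
elim: s => [_|k s IH /=/andP[ks us]].
  rewrite !big_nil mulr0; have -> : mix [::] = u by apply/colP => j; rewrite mxE.
  by rewrite subrr subr0 normr0.
rewrite !big_cons; set w := v k 0 - u k 0.
pose path y : R := G t (mix s + y *: delta_mx k 0) i 0.
have mixk : mix (k :: s) = mix s + w *: delta_mx k 0.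
  apply/colP => j; rewrite !mxE inE eqxx andbT /w.
  have [->|jk] /= := eqVneq j k; first by rewrite (negPf ks) mulr1 addrC subrK.
  by rewrite mulr0 addr0.
have mix0 : mix s = mix s + 0 *: delta_mx k 0 by rewrite scale0r addr0.
pose dpath y : R := D k (mix s + y *: delta_mx k 0) i 0.
have dP y : is_derive y (1 : R) path (dpath y).
  have : (fun h => h^-1 *: ((G t \o shift (mix s + y *: delta_mx k 0))
      (h *: delta_mx k 0) - G t (mix s + y *: delta_mx k 0)))
      @ (0 : R)^' --> D k (mix s + y *: delta_mx k 0).
    by rewrite DE; exact: dG.
  move=> /(cvg_comp _ _)/(_ (@coord_continuous _ _ _ i 0 _)) L.
  have L' : (fun h => h^-1 *: ((path \o shift y) (h *: 1) - path y))
      @ (0 : R)^' --> dpath y.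
    apply: cvg_eqfun L => h /=; rewrite !mxE [h *: 1]mulr1 /path.
    congr (_ * (G t _ i 0 - _)).
    by rewrite addrCA -scalerDl.
  apply: DeriveDef; first by apply/cvg_ex; exists (dpath y).
  exact: cvg_lim L'.
have := @mean_value_estimate path dpath 0 w (c k) e (fun y _ => dP y).
rewrite subr0 => M.
have -> : G t (mix (k :: s)) i 0 - G t u i 0 -
    (c k * w + \sum_(j <- s) c j * (v j 0 - u j 0)) =
    (path w - path 0 - c k * w) +
    (G t (mix s) i 0 - G t u i 0 - \sum_(j <- s) c j * (v j 0 - u j 0)).
  by rewrite mixk {2}mix0 /path; ring.
rewrite [e * _]mulrDr; apply: (le_trans (ler_normD _ _)); apply: lerD; last exact: IH.
apply: M => [|y /andP[y1 y2]].
  apply: continuous_subspaceT => y; apply/differentiable_continuous.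
  by apply/derivable1_diffP; case: (dP y).
apply: bound => j; rewrite !mxE eqxx andbT.
have [->|jk] /= := eqVneq j k; last first.
  by rewrite mulr0 addr0; case: ifP => // _; rewrite subrr normr0.
rewrite (negPf ks) mulr1 addrAC subrr add0r -/w.
move: y1 y2; rewrite gt_min lt_max.
have [w0|w0] := leP 0 w => y1 y2.
  rewrite [`|w|]ger0_norm // ler_norml.
  by case/orP: y1; case/orP: y2 => ? ?; apply/andP; split; lra.
rewrite [`|w|]ltr0_norm // ler_norml.
by case/orP: y1; case/orP: y2 => ? ?; apply/andP; split; lra.
Qed.

(** First t moves from x with u fixed, where the derivative is one-sided at the
    ends, then the coordinates move with t fixed; near (x, u) the slopes met on
    the way are close to those at (x, u) because the partial derivatives are
    jointly continuous. *)
Lemma first_order G x u (e : R) :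
  jcont G -> (forall t v, A t -> derivable_within A (G ^~ v) t) ->
  jcont (fun t v => derive_within A (G ^~ v) t) ->
  (forall j t v, A t -> derivable (G t) v (delta_mx j 0)) ->
  (forall j, jcont (fun t v => 'D_(delta_mx j 0) (G t) v)) ->
  A x -> 0 < e ->
  exists2 r, 0 < r & forall t v, A t -> `|t - x| < r ->
    (forall j, `|v j 0 - u j 0| < r) -> forall i,
    `|G t v i 0 - G x u i 0 - derive_within A (G ^~ u) x i 0 * (t - x)
      - \sum_j 'D_(delta_mx j 0) (G x) u i 0 * (v j 0 - u j 0)| <=
    e * (`|t - x| + \sum_j `|v j 0 - u j 0|).
Proof.
move=> cG dt ct dj cj Ax e0.
have [r1 r10 b1] := jcont_eps _ _ u _ ct Ax e0.
have [r2 r20 b2] : exists2 r, 0 < r & forall j t v, A t -> `|t - x| < r ->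
    (forall j, `|v j 0 - u j 0| < r) -> forall i,
    `|'D_(delta_mx j 0) (G t) v i 0 - 'D_(delta_mx j 0) (G x) u i 0| <= e.
  have C j := jcont_eps _ _ u _ (cj j) Ax e0.
  pose rr j := projT1 (cid2 (C j)).
  have rrP j : 0 < rr j /\ forall t v, A t -> `|t - x| < rr j ->
    (forall k, `|v k 0 - u k 0| < rr j) -> forall i,
    `|'D_(delta_mx j 0) (G t) v i 0 - 'D_(delta_mx j 0) (G x) u i 0| <= e.
    by rewrite /rr; case: (cid2 (C j)).
  exists (\big[Num.min/1]_j rr j).
    by elim/big_ind: _ => // [p q p0 q0|j _]; [rewrite lt_min p0|case: (rrP j)].
  move=> j t v At tx vu; apply: (rrP j).2 => //.
    by apply: lt_le_trans tx _; rewrite bigmin_le_cond.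
  by move=> k; apply: lt_le_trans (vu k) _; rewrite bigmin_le_cond.
exists (Num.min r1 r2); first by rewrite lt_min r10.
move=> t v At tx vu i.
have tx1 : `|t - x| < r1 by apply: lt_le_trans tx _; rewrite ge_min lexx.
have tx2 : `|t - x| < r2 by apply: lt_le_trans tx _; rewrite ge_min lexx orbT.
have vu2 j : `|v j 0 - u j 0| < r2.
  by apply: lt_le_trans (vu j) _; rewrite ge_min lexx orbT.
have -> : G t v i 0 - G x u i 0 - derive_within A (G ^~ u) x i 0 * (t - x)
    - \sum_j 'D_(delta_mx j 0) (G x) u i 0 * (v j 0 - u j 0) =
  (G t u i 0 - G x u i 0 - derive_within A (G ^~ u) x i 0 * (t - x)) +
  (G t v i 0 - G t u i 0 - \sum_j 'D_(delta_mx j 0) (G x) u i 0 * (v j 0 - u j 0)).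
  by ring.
rewrite [e * _]mulrDr; apply: (le_trans (ler_normD _ _)); apply: lerD; last first.
  apply: (@coordinate_estimate G t u v (fun j w => 'D_(delta_mx j 0) (G t) w)) => //.
    by move=> j w; apply: dj.
  by move=> j w wv; apply: b2 => // k; apply: le_lt_trans (wv k) (vu2 k).
have Axt y : Num.min x t <= y <= Num.max x t -> A y.
  move: Ax At; rewrite /A /= !in_itv /= => /andP[ax xb] /andP[at_ tb].
  move=> /andP[]; rewrite ge_min le_max => y1 y2.
  apply/andP; split.
    by case/orP: y1; apply: le_trans.
  by case/orP: y2 => h; apply: le_trans h _.
apply: (@mean_value_estimate (fun y => G y u i 0)
  (fun y => derive_within A (G ^~ u) y i 0)) => [y y12||y y12].
- have Ay : A y by apply: Axt; case/andP: y12 => y1 y2; rewrite !ltW.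
  apply: (@quotient_within_is_derive _ a b).
    move: y12 Ax At; rewrite gt_min lt_max /A /= !in_itv /=.
    move=> /andP[y1 y2] /andP[ax xb] /andP[at_ tb].
    apply/andP; split.
      by case/orP: y1 => h; apply: le_lt_trans h.
    by case/orP: y2 => h; apply: lt_le_trans h _.
  by apply: quotient_within_coord; apply: dt.
- apply: (@continuous_subspaceW _ _ _ A).
    by move=> y; rewrite /= in_itv => /Axt.
  have := jcont_fst G u cG.
  move=> /subspace_continuousP c; apply/subspace_continuousP => y Ay.
  exact: (cvg_comp _ _ (c y Ay) (@coord_continuous _ _ _ i 0 _)).
- have Ay : A y by apply: Axt; case/andP: y12 => y1 y2; rewrite !ltW.
  apply: b1 => // [|j]; last by rewrite subrr normr0.
  apply: le_lt_trans tx1.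
  move: y12; rewrite gt_min lt_max => /andP[y1 y2].
  have [xt|xt] := leP x t.
    rewrite [`|t - x|]ger0_norm ?subr_ge0 // ler_norml.
    by case/orP: y1; case/orP: y2 => ? ?; apply/andP; split; lra.
  rewrite [`|t - x|]ltr0_norm ?subr_lt0 // ler_norml.
  by case/orP: y1; case/orP: y2 => ? ?; apply/andP; split; lra.
Qed.

End FirstOrder.
End ChainRule.

Section Composition.
Context {R : realType} {d : nat} (a b : R).
Hypothesis ab : a < b.
Let A : set R := `[a, b].
Implicit Types (G : R -> 'cV[R]_d -> 'cV[R]_d) (U W : 'cV[{poly R}]_d) (x t : R).

Lemma cvg_coord (T : Type) (F : set_system T) (f : T -> 'cV[R]_d)
    (l : 'cV[R]_d) : Filter F ->
  (forall i, (fun t : T => f t i 0) @ F --> l i 0) -> f @ F --> l.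
Proof.
move=> FF fl; apply/cvg_ballP => e e0.
have : \forall t \near F, forall i, ball (l i 0) e (f t i 0).
  by apply: filter_forall => i; have /cvg_ballP := fl i; exact.
by apply: filterS => t H; split=> // i j; rewrite [j]ord1.
Qed.

(** The difference quotient differs from the linearized one by a remainder that
    the first-order estimate bounds by any given multiple of 1 + sum |del j|,
    and the quotients del j of the polynomial path are bounded. *)
Lemma chain_rule G W x :
  {within A `*` setT, continuous (fun z : R * 'cV[R]_d => G z.1 z.2)} ->
  (forall t v, A t -> derivable_within A (G ^~ v) t) ->
  {within A `*` setT, continuous
    (fun z : R * 'cV[R]_d => derive_within A (G ^~ z.2) z.1)} ->
  (forall j t v, A t -> derivable (G t) v (delta_mx j 0)) ->
  (forall j, {within A `*` setT, continuous
    (fun z : R * 'cV[R]_d => 'D_(delta_mx j 0) (G z.1) z.2)}) ->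
  A x ->
  quotient_within A (fun t => G t (vhorner W t)) x -->
    derive_within A (G ^~ (vhorner W x)) x +
    \sum_j (W j 0)^`().[x] *: 'D_(delta_mx j 0) (G x) (vhorner W x).
Proof.
move=> cG dt ct dj cj Ax.
set u := vhorner W x; set gt := derive_within _ _ _.
pose gj j := 'D_(delta_mx j 0) (G x) u.
have FF := within_quotient_proper a b ab x Ax.
set F := within _ _ in FF.
have FF0 : Filter F by exact: filter_filter.
have hF : (id : R -> R) @ F --> (0 : R).
  by apply: cvg_within_filter; exact: cvg_within.
have h0F : \forall h \near F, h != 0.
  by rewrite near_withinE; apply: filterS (nbhs_dnbhs_neq (0 : R)).
pose del j (h : R) := h^-1 * ((W j 0).[x + h] - (W j 0).[x]).
have delF j : del j @ F --> (W j 0)^`().[x].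
  exact: (is_derive_quotient_within _ _ _ _ _ (is_derive_poly (W j 0) x)).
apply: cvg_coord => i.
pose main h := gt i 0 + \sum_j gj j i 0 * del j h.
have mainF : main @ F --> (gt + \sum_j (W j 0)^`().[x] *: gj j) i 0.
  rewrite !mxE summxE; apply: cvgD; first exact: cvg_cst.
  apply: cvg_big => [|j _]; first exact: add_continuous.
  by rewrite mxE mulrC; apply: cvgM => //; exact: cvg_cst.
pose rem h := (h^-1 *: (G (x + h) (vhorner W (x + h)) - G x u)) i 0 - main h.
suff remF : rem @ F --> 0.
  rewrite -[X in _ --> X]addr0; apply: cvg_eqfun (cvgD mainF remF) => h /=.
  by rewrite fctE /= /rem addrC subrK.
pose K := 1 + \sum_j (`|(W j 0)^`().[x]| + 1).
have K0 : 0 < K by rewrite ltr_pwDl // sumr_ge0 // => j _; rewrite addr_ge0.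
apply/cvgr0Pnorm_le => e e0.
have [|r r0 Hr] := first_order a b G x u (e / K) cG dt ct dj cj Ax.
  by rewrite divr_gt0.
near=> h.
have h0 : h != 0 by near: h.
have Axh : A (x + h) by near: h; exact: withinT.
have hr : `|h| < r by near: h; exact: (cvgr0_norm_lt _ hF _ r0).
have delb : forall j, `|del j h| <= `|(W j 0)^`().[x]| + 1.
  near: h; apply: filter_forall => j.
  have /cvgrPdist_le/(_ _ ltr01) := delF j; apply: filterS => h'.
  rewrite distrC => dp; rewrite -(subrK (W j 0)^`().[x] (del j h')) addrC.
  by apply: (le_trans (ler_normD _ _)); rewrite lerD2l.
have delE j : vhorner W (x + h) j 0 - u j 0 = h * del j h.
  by rewrite !mxE /del mulrA divff // mul1r.
have Wr : forall j, `|vhorner W (x + h) j 0 - u j 0| < r.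
  near: h; apply: filter_forall => j.
  have Wc : (fun h => (W j 0).[x + h] - (W j 0).[x]) @ F --> 0.
    rewrite -(subrr (W j 0).[x]); apply: cvgB; last exact: cvg_cst.
    have xh : (fun h : R => x + h) @ F --> x.
      rewrite -{2}[x]addr0.
      by apply: (@cvgD _ _ _ _ _ (cst x) id) => //; exact: cvg_cst.
    exact: (cvg_comp _ _ xh (@continuous_horner _ (W j 0) x)).
  have := @cvgr0_norm_lt _ _ _ F FF0 _ Wc _ r0; apply: filterS => h'.
  by rewrite !mxE.
have := Hr (x + h) (vhorner W (x + h)) Axh _ Wr i.
have -> : x + h - x = h by rewrite addrC addKr.
move=> /(_ hr) B.
have -> : rem h = h^-1 * (G (x + h) (vhorner W (x + h)) i 0 - G x u i 0 -
    gt i 0 * h - \sum_j gj j i 0 * (vhorner W (x + h) j 0 - u j 0)).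
  rewrite /rem /main !mxE.
  under [X in _ = _ * (_ - X)]eq_bigr => j _ do rewrite delE mulrCA.
  by rewrite -mulr_sumr; field.
rewrite normrM normfV ler_pdivrMl ?normr_gt0 //; apply: (le_trans B).
have -> : `|h| * e = e / K * (`|h| * K) by field; rewrite gt_eqF.
rewrite ler_wpM2l ?divr_ge0 ?(ltW e0) ?(ltW K0) //.
rewrite /K mulrDr mulr1 lerD2l mulr_sumr; apply: ler_sum => j _.
by rewrite delE normrM ler_wpM2l.
Unshelve. all: by end_near.
Qed.

(** Induction on the order of smoothness: by the chain rule the derivative of
    G(t, W(t)) is again a combination, with polynomial coefficients, of
    compositions of W with partial derivatives of G, which are smooth of one
    order less. *)
Lemma contact_comp m n G U W x : A x -> (n <= m.+1)%N -> Cn_on A m G ->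
  (forall j i, (i < n)%N -> (U j 0)^`(i).[x] = (W j 0)^`(i).[x]) ->
  contact a b x n m (fun t => G t (vhorner U t)) (fun t => G t (vhorner W t)).
Proof.
move=> Ax; elim: m n G => [|m IH] n G nm.
  move=> _ UW; apply/contact0 => // n0; congr (G x _); apply/colP => j.
  by rewrite !mxE; exact: (UW j 0%N).
move=> [cG [dt Ct dj Cj]] UW.
have ct : {within A `*` setT, continuous
    (fun z : R * 'cV[R]_d => derive_within A (G ^~ z.2) z.1)}.
  by case: m Ct {IH nm Cj} => [[]|m []].
have cj j : {within A `*` setT, continuous
    (fun z : R * 'cV[R]_d => 'D_(delta_mx j 0) (G z.1) z.2)}.
  by have := Cj j; case: m {IH nm Ct Cj} => [[]|m []].
have L V y : A y -> _ := chain_rule G V y cG dt ct dj cj.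
apply/contactS; split.
- by move=> y Ay; apply: derivable_withinE; exact: L.
- by move=> y Ay; apply: derivable_withinE; exact: L.
- move=> n0; congr (G x _); apply/colP => j.
  by rewrite !mxE; exact: (UW j 0%N).
have nm' : (n.-1 <= m.+1)%N by lia.
have UW' j i : (i < n.-1)%N -> (U j 0)^`(i).[x] = (W j 0)^`(i).[x].
  by move=> ni; apply: UW; lia.
have UW1 j i : (i < n.-1)%N -> (U j 0)^`()^`(i).[x] = (W j 0)^`()^`(i).[x].
  by move=> ni; rewrite -!derivSn; apply: UW; lia.
apply: contact_ext; last first.
  apply: (contactD a b ab x _ _ _ _ _ _ Ax nm' (IH _ _ nm' Ct UW')).
  apply: (contact_sum a b ab x _ _ _ (index_enum _) _ _ Ax nm') => j.
  exact: (contact_polyZ a b ab x _ _ _ _ _ _ Ax nm' (UW1 j) (IH _ _ nm' (Cj j) UW')).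
- by move=> y Ay; apply/esym/derive_withinE => //; exact: L.
- by move=> y Ay; apply/esym/derive_withinE => //; exact: L.
- by [].
- by [].
- by [].
Qed.

End Composition.

(** * The nodal polynomial and exactness of the quadrature *)

Section Quadrature.
Context {R : realType} (r k : nat) (a b : R).
Hypotheses (ab : a < b) (kr : (k <= r)%N).
Implicit Types (p q : {poly R}) (x : R).

Let al := uphalf k.
Let be := k./2.+1.
Let n := (r - k)%N.

Lemma uphalf_leS : (al <= k./2.+1)%N.
Proof. by rewrite /al uphalf_half; case: odd. Qed.

Lemma uphalf_half_sum : (al + be = k.+1)%N.
Proof. by rewrite /al /be uphalf_half -{3}(odd_double_half k); lia. Qed.

Lemma jacobi_nodesP : exists zs : seq R,
  [/\ uniq zs, all (fun z => -1 < z < 1) zs, size zs = n,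
      jacobi R n be al = \prod_(z <- zs) ('X - z%:P) &
      forall x, @jacobi_nodes R r k x <-> x \in zs].
Proof.
have [Jm sJ oJ] := @jacobiP R n be al.
have N11 : -1 < 1 :> R by lra.
have [zs [uzs azs szs EJ]] := orthogonal_roots _ _ _ _ _ N11
  (jacobi_weight_neq0 be al) (jacobi_weight_ge0 be al) Jm sJ oJ.
exists zs; split => // x.
by rewrite /jacobi_nodes /= -/n -/al -/be EJ root_prod_XsubC.
Qed.

Definition ref_nodes : seq R := projT1 (cid jacobi_nodesP).

Lemma ref_nodesP :
  [/\ uniq ref_nodes, all (fun z => -1 < z < 1) ref_nodes, size ref_nodes = n,
      jacobi R n be al = \prod_(z <- ref_nodes) ('X - z%:P) &
      forall x, @jacobi_nodes R r k x <-> x \in ref_nodes].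
Proof. by rewrite /ref_nodes; case: cid. Qed.

Definition nodes : seq R := [seq aff a b z | z <- ref_nodes].

(** Monic of degree r + 1, it vanishes to the prescribed orders at all nodes:
    two polynomials have the same Hermite data exactly when they are congruent
    modulo it, so interpolation is reduction modulo node_poly. *)
Definition node_poly : {poly R} := nodal al be a b nodes.
Local Notation om := node_poly.
Let ref_om := nodal al be (-1) 1 ref_nodes.

Definition affp : {poly R} := ((b - a) / 2) *: 'X + ((a + b) / 2)%:P.

Let ba0 : b - a != 0. Proof. by rewrite subr_eq0 gt_eqF. Qed.

Lemma horner_affp x : affp.[x] = aff a b x.
Proof. by rewrite /affp /aff !hornerE; field. Qed.

Lemma size_affp : size affp = 2.
Proof.
rewrite /affp size_polyDl ?size_scale ?size_polyX ?mulf_neq0 ?invr_neq0 ?pnatr_eq0 //.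
by rewrite size_polyC; case: eqP.
Qed.

Lemma deriv_affp : affp^`() = ((b - a) / 2)%:P.
Proof. by rewrite /affp derivD derivZ derivX derivC addr0 alg_polyC. Qed.

Lemma affpK p : (p \Po affp) \Po aff_inv a b = p.
Proof.
rewrite -comp_polyA [affp \Po _](_ : _ = 'X) ?comp_polyXr //.
rewrite /affp /aff_inv comp_polyD comp_polyZ comp_polyX comp_polyC.
rewrite scalerA mulrAC divff // mul1r scalerBr scalerA mulVf ?pnatr_eq0 //.
by rewrite scale1r -mul_polyC -polyCM mulrC subrK.
Qed.

Lemma aff_inj : injective (aff a b).
Proof.
move=> x y; rewrite /aff => /mulIf; rewrite invr_eq0 pnatr_eq0 => /(_ isT).
by move=> /addrI /mulfI; apply.
Qed.

Lemma affN1 : aff a b (-1) = a. Proof. by rewrite /aff; field. Qed.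
Lemma aff1 : aff a b 1 = b. Proof. by rewrite /aff; field. Qed.

Let uref : uniq ref_nodes. Proof. by case: ref_nodesP. Qed.
Let N1ref : -1 \notin ref_nodes.
Proof.
case: ref_nodesP => _ /allP H _ _ _; apply/negP => /H.
by rewrite ltxx.
Qed.
Let ref1 : 1 \notin ref_nodes.
Proof.
case: ref_nodesP => _ /allP H _ _ _; apply/negP => /H.
by rewrite ltxx andbF.
Qed.
Let N11 : (-1 : R) != 1. Proof. by rewrite lt_eqF //; lra. Qed.

Let unodes : uniq nodes. Proof. by rewrite map_inj_uniq //; exact: aff_inj. Qed.
Let anodes : a \notin nodes.
Proof. by rewrite -{1}affN1 mem_map //; exact: aff_inj. Qed.
Let bnodes : b \notin nodes.
Proof. by rewrite -{1}aff1 mem_map //; exact: aff_inj. Qed.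
Let aNb : a != b. Proof. by rewrite lt_eqF. Qed.

Lemma size_node_poly : size om = r.+2.
Proof.
rewrite size_nodal /nodes size_map uphalf_half_sum; case: ref_nodesP => _ _ -> _ _.
by rewrite addSn subnKC.
Qed.

Lemma node_poly_monic : om \is monic. Proof. exact: nodal_monic. Qed.

Lemma node_poly_b : om.[b] = 0.
Proof.
rewrite /node_poly /nodal !hornerM !horner_exp !hornerXsubC subrr.
by rewrite expr0n mulr0 mul0r.
Qed.

Lemma node_poly_a : (om.[a] == 0) = (0 < k)%N.
Proof.
apply/idP/idP => [|k0].
  apply: contraTT; rewrite -eqn0Ngt => /eqP k0.
  rewrite /node_poly /nodal /al k0 expr0 mul1r hornerM mulf_neq0 //.
    by rewrite horner_exp hornerXsubC expf_neq0 // subr_eq0.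
  by rewrite -rootE root_prod_XsubC.
rewrite /node_poly /nodal !hornerM !horner_exp !hornerXsubC subrr /al uphalfE.
by case: k k0 => // k' _; rewrite /= expr0n !mul0r.
Qed.

Lemma comp_prod_XsubC (zs : seq R) :
  (\prod_(z <- [seq aff a b z | z <- zs]) ('X - z%:P)) \Po affp =
  ((b - a) / 2) ^+ size zs *: \prod_(z <- zs) ('X - z%:P).
Proof.
elim: zs => [|z zs IH]; first by rewrite !big_nil scale1r comp_polyC.
rewrite /= !big_cons comp_polyM IH comp_polyB comp_polyX comp_polyC.
rewrite [affp - _](_ : _ = ((b - a) / 2) *: ('X - z%:P)).
  by rewrite -scalerAr -scalerAl scalerA exprSr.
rewrite /affp /aff scalerBr -addrA; congr (_ + _).
rewrite -polyCN -polyCD -mul_polyC -polyCM -polyCN; congr _%:P.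
by field.
Qed.

Lemma node_poly_affp : exists c, om \Po affp = c *: ref_om.
Proof.
have E z (m : nat) : (('X - (aff a b z)%:P) ^+ m) \Po affp =
    ((b - a) / 2) ^+ m *: ('X - z%:P) ^+ m.
  have := comp_prod_XsubC (nseq m z).
  by rewrite map_nseq !big_nseq size_nseq !iter_mulr_1.
exists (((b - a) / 2) ^+ al * ((b - a) / 2) ^+ be * ((b - a) / 2) ^+ size ref_nodes).
have Ea := E (-1) al; have Eb := E 1 be; rewrite affN1 in Ea; rewrite aff1 in Eb.
rewrite /node_poly /nodal !comp_polyM Ea Eb comp_prod_XsubC.
have scale3 (x y z : R) (A B C : {poly R}) :
    x *: A * (y *: B) * (z *: C) = (x * y * z) *: (A * B * C).
  by rewrite -!mul_polyC !polyCM; ring.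
by rewrite scale3.
Qed.

(** The nodal polynomial is, up to a constant, the Jacobi polynomial times the
    weight to which it is orthogonal. *)
Lemma node_poly_orthogonal q : (size q <= n)%N -> intp a b (om * q) = 0.
Proof.
move=> sq; have [c Ec] := node_poly_affp.
have := intp_comp (-1) 1 ((b - a) / 2) (om * q) affp deriv_affp.
rewrite !horner_affp affN1 aff1 => <-.
rewrite comp_polyM Ec.
have [Jm sJ oJ] := @jacobiP R n be al.
have -> : c *: ref_om * (q \Po affp) = (c * (-1) ^+ be) *:
    (jacobi_weight be al * jacobi R n be al * (q \Po affp)).
  case: ref_nodesP => _ _ _ EJ _; rewrite /ref_om /nodal -EJ /jacobi_weight.
  have -> : (1 - 'X : {poly R}) = (-1) *: ('X - 1%:P) by rewrite scaleN1r opprB.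
  have -> : (1 + 'X : {poly R}) = 'X - (-1)%:P by rewrite polyCN opprK addrC.
  have sgn2 : (-1) ^+ be * (-1) ^+ be = 1 :> R.
    by rewrite -exprMn mulrNN mulr1 expr1n.
  rewrite exprZn -!scalerAl scalerA -[c * _ * _]mulrA sgn2 mulr1.
  by congr (_ *: (_ * _)); rewrite -mulrA mulrCA mulrA.
rewrite intpZ oJ ?mulr0 //.
by rewrite size_comp_poly2 // size_affp.
Qed.

(** Gauss-type exactness: the quotient of p by the nodal polynomial has degree at
    most r - k - 1, to which the nodal polynomial is orthogonal. *)
Lemma intp_mod p : (size p <= n + r.+1)%N -> intp a b (p %% om) = intp a b p.
Proof.
move=> sp; rewrite [in RHS](divp_eq p om) intpD mulrC node_poly_orthogonal ?add0r //.
by rewrite size_divp ?monic_neq0 ?node_poly_monic // size_node_poly /= leq_subLR addnC.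
Qed.

(** Agreement in everything that the Hermite interpolant on [a, b] depends on. *)
Definition data_eq {V : normedModType R} (f g : R -> V) :=
  [/\ contact a b a al k./2 f g, contact a b b be k./2 f g &
      forall z, z \in nodes -> f z = g z].

Let Aa : `[a, b]%classic a. Proof. by rewrite /= in_itv /= lexx ltW. Qed.
Let Ab : `[a, b]%classic b. Proof. by rewrite /= in_itv /= lexx andbT ltW. Qed.

Lemma data_eq_sym {V : normedModType R} (f g : R -> V) :
  data_eq f g -> data_eq g f.
Proof.
by move=> [ca cb cz]; split; [exact: contact_sym|exact: contact_sym|move=> z /cz].
Qed.

Lemma data_eq_trans {V : normedModType R} (f g h : R -> V) :
  data_eq f g -> data_eq g h -> data_eq f h.
Proof.
move=> [ca cb cz] [ca' cb' cz']; split => [||z zz].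
- exact: contact_trans ca ca'.
- exact: contact_trans cb cb'.
- by rewrite cz // cz'.
Qed.

Lemma data_eq_polyZ {V : normedModType R} p (f g : R -> V) :
  data_eq f g -> data_eq (fun t => p.[t] *: f t) (fun t => p.[t] *: g t).
Proof.
move=> [ca cb cz]; split => [||z /cz -> //].
- exact: (contact_polyZ a b ab a _ _ p p _ _ Aa uphalf_leS).
- exact: (contact_polyZ a b ab b _ _ p p _ _ Ab).
Qed.

Lemma data_eq_sum {V : normedModType R} (I : Type) (s : seq I)
    (f g : I -> R -> V) : (forall i, data_eq (f i) (g i)) ->
  data_eq (fun t => \sum_(i <- s) f i t) (fun t => \sum_(i <- s) g i t).
Proof.
move=> H; split => [||z zz].
- by apply: contact_sum => // [|i]; [exact: uphalf_leS|case: (H i)].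
- by apply: contact_sum => // i; case: (H i).
- by apply: eq_bigr => i _; case: (H i) => _ _ ->.
Qed.

Lemma data_eq_coord d (f g : R -> 'cV[R]_d) j : data_eq f g ->
  data_eq (fun t => f t j 0) (fun t => g t j 0).
Proof.
move=> [ca cb cz]; split => [||z /cz -> //].
- by apply: contact_coord => //; exact: uphalf_leS.
- exact: contact_coord.
Qed.

Lemma node_poly_dvdP p q :
  om %| p - q <->
  [/\ forall i, (i < al)%N -> p^`(i).[a] = q^`(i).[a],
      forall i, (i < be)%N -> p^`(i).[b] = q^`(i).[b] &
      forall z, z \in nodes -> p.[z] = q.[z]].
Proof.
have E (i : nat) x : (p - q)^`(i).[x] = p^`(i).[x] - q^`(i).[x].
  by rewrite derivnB hornerD hornerN.
split=> [/(nodal_dvdP _ _ _ _ _ aNb unodes anodes bnodes)[pa pb pz]|[pa pb pz]].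
  split=> [i /pa /eqP|i /pb /eqP|z /pz /eqP].
  - by rewrite E subr_eq0 => /eqP.
  - by rewrite E subr_eq0 => /eqP.
  - by rewrite hornerD hornerN subr_eq0 => /eqP.
apply/nodal_dvdP => //; split=> [i ni|i ni|z zz].
- by rewrite E pa // subrr.
- by rewrite E pb // subrr.
- by rewrite hornerD hornerN pz // subrr.
Qed.

Lemma data_eq_poly p q : om %| p - q -> data_eq (horner p) (horner q).
Proof.
move=> /node_poly_dvdP[pa pb pz]; split => //.
- by apply: contact_poly => //; exact: uphalf_leS.
- exact: contact_poly.
Qed.

Lemma data_eq_comp d (F : R -> 'cV[R]_d -> 'cV[R]_d) (U W : 'cV[{poly R}]_d) :
  Cn_on `[a, b] k./2 F -> (forall j, om %| U j 0 - W j 0) ->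
  data_eq (fun t => F t (vhorner U t)) (fun t => F t (vhorner W t)).
Proof.
move=> sF UW; have H j := (node_poly_dvdP _ _).1 (UW j).
split=> [||z zz].
- by apply: contact_comp => //; [exact: uphalf_leS|move=> j; case: (H j)].
- by apply: contact_comp => // j; case: (H j).
- congr (F z _); apply/colP => j; rewrite !mxE.
  by case: (H j) => _ _ ->.
Qed.

(** The interpolant depends on f only through its data, so it may be computed
    from any polynomial with the same data; on polynomials it is the remainder
    modulo the nodal polynomial. Uniqueness of the interpolant is settled on the
    reference interval, where the operator is defined. *)
Lemma hermiteE (f : R -> R) p : data_eq f (horner p) ->
  hermite r k a b f = p %% om.
Proof.
move=> fp; set q := p %% om.
have sq : (size q <= r.+1)%N.
  by have := ltn_modpN0 p (monic_neq0 node_poly_monic); rewrite size_node_poly.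
have {}fp : data_eq f (horner q).
  apply: data_eq_trans fp _; apply: data_eq_poly.
  by rewrite {1}(divp_eq p om) addrK dvdp_mull.
rewrite /hermite -[RHS]affpK; congr (_ \Po _).
have lt11 : (-1 : R) < 1 by lra.
have N1i : -1 <= (-1 : R) <= 1 by rewrite lexx ltW.
have i1 : -1 <= (1 : R) <= 1 by rewrite lexx ltW.
have hq : horner q \o aff a b = horner (q \Po affp).
  by apply/funext => x; rewrite /= horner_comp horner_affp.
have [ca cb cz] := fp.
have Da (i : nat) : (i < al)%N ->
    (q \Po affp)^`(i).[-1] = deriven_within `[-1, 1] i (f \o aff a b) (-1).
  have ca' : contact a b (aff a b (-1)) al k./2 f (horner q) by rewrite affN1.
  have [_ _ E] := contact_aff a b ab _ _ _ _ _ N1i uphalf_leS ca'.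
  by move=> /E ->; rewrite hq deriven_within_poly //= in_itv.
have Db (i : nat) : (i < be)%N ->
    (q \Po affp)^`(i).[1] = deriven_within `[-1, 1] i (f \o aff a b) 1.
  have cb' : contact a b (aff a b 1) be k./2 f (horner q) by rewrite aff1.
  have [_ _ E] := contact_aff a b ab _ _ _ _ _ i1 (leqnn _) cb'.
  by move=> /E ->; rewrite hq deriven_within_poly //= in_itv.
have Dz x : x \in ref_nodes -> (q \Po affp).[x] = (f \o aff a b) x.
  by move=> xz; rewrite horner_comp horner_affp /= cz // map_f.
have sqa : (size (q \Po affp) <= r.+1)%N by rewrite size_comp_poly2 ?size_affp.
have [_ _ _ _ JN] := ref_nodesP.
rewrite /hermite_ref; case: xgetP => [h _ [sh ha hb hz]|]; last first.
  move=> /(_ (q \Po affp)) [].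
  by split => // x /JN/Dz.
apply/eqP; rewrite -subr_eq0.
have : ref_om %| h - (q \Po affp).
  apply/nodal_dvdP => //; split => [i ni|i ni|z zz].
  - by rewrite derivnB hornerD hornerN ha // Da // subrr.
  - by rewrite derivnB hornerD hornerN hb // Db // subrr.
  - by rewrite hornerD hornerN hz ?JN // Dz // subrr.
apply: contraTT => h0; apply/negP => /(dvdp_leq h0).
rewrite size_nodal uphalf_half_sum; have [_ _ -> _ _] := ref_nodesP.
rewrite addSn subnKC // leqNgt ltnS => /negP; apply.
by rewrite (leq_trans (size_polyD _ _)) // size_polyN geq_max sh.
Qed.

Lemma data_eq_polyP (f : R -> R) p : smooth a b k./2 f ->
  data_eq f (horner p) <->
  [/\ forall i, (i < al)%N -> deriven_within `[a, b] i f a = p^`(i).[a],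
      forall i, (i < be)%N -> deriven_within `[a, b] i f b = p^`(i).[b] &
      forall z, z \in nodes -> f z = p.[z]].
Proof.
move=> sf; split=> [[[_ _ ca] [_ _ cb] cz]|[ca cb cz]].
  split => // i ni.
  - by rewrite ca // deriven_within_poly.
  - by rewrite cb // deriven_within_poly.
have [_ sp _] : contact a b a 0 k./2 (horner p) (horner p) by exact: contact_poly.
split=> //; split=> // i ni.
- by rewrite ca // deriven_within_poly.
- by rewrite cb // deriven_within_poly.
Qed.

Lemma data_eq_interpolant (f : R -> R) : smooth a b k./2 f ->
  exists2 p : {poly R}, (size p <= r.+1)%N & data_eq f (horner p).
Proof.
move=> sf.
have [q [qa qb qz]] := hermite_interpolant al be a b nodes aNb unodes anodes
  bnodes (fun i => deriven_within `[a, b] i f a)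
  (fun i => deriven_within `[a, b] i f b) f.
exists (q %% om).
  by have := ltn_modpN0 q (monic_neq0 node_poly_monic); rewrite size_node_poly.
apply: (data_eq_trans f (horner q)).
  by apply/data_eq_polyP => //; split=> [i /qa ->|i /qb ->|z /qz ->].
by apply: data_eq_poly; rewrite {1}(divp_eq q om) addrK dvdp_mull.
Qed.

Lemma node_poly_derivn_b_neq0 : om^`(be).[b] != 0.
Proof.
rewrite /node_poly /nodal mulrAC; apply: derivn_XsubC_exp_neq0.
rewrite hornerM horner_exp hornerXsubC mulf_neq0 //.
  by rewrite expf_neq0 // subr_eq0 eq_sym.
by rewrite -rootE root_prod_XsubC.
Qed.

Lemma quad_exact (f : R -> R) p : data_eq f (horner p) ->
  (size p <= n + r.+1)%N -> quad r k a b f = intp a b p.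
Proof.
by move=> fp sp; rewrite /quad Rintegral_poly_oc // (hermiteE _ _ fp) intp_mod.
Qed.

Lemma intp_node_poly_parts p : (size p <= n.+1)%N ->
  intp a b (om^`() * p) = - (om.[a] * p.[a]).
Proof.
move=> sp; have -> : om^`() * p = (om * p)^`() - om * p^`().
  by rewrite derivM addrK.
rewrite intpB intp_deriv node_poly_orthogonal.
  by rewrite !(hornerM om p) node_poly_b mul0r subr0 sub0r.
by apply: leq_trans (size_poly _ _) _; rewrite -subn1 leq_subLR.
Qed.

End Quadrature.

(** * Collocation and variational time discretization *)

Section Equivalence.
Context {R : realType} {d : nat} (M : 'M[R]_d).
Context (F : R -> 'cV[R]_d -> 'cV[R]_d) (a b : R) (uprev : 'cV[R]_d) (r k : nat).
Hypotheses (M_regular : M \in unitmx) (ab : a < b) (kr : (k <= r)%N).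
Hypothesis F_smooth : Cn_on `[a, b] k./2 F.
Implicit Types (U W phi : 'cV[{poly R}]_d) (c : 'cV[R]_d).

Local Notation om := (node_poly r k a b).
Local Notation data_eq := (data_eq r k a b).

Let FU U t := F t (vhorner U t).

Definition mass_deriv U : 'cV[{poly R}]_d :=
  \col_j \sum_l M j l *: (U l 0)^`().

Definition dot U phi : {poly R} := \sum_j U j 0 * phi j 0.

Lemma mass_derivE U i x j :
  (M *m vhorner (vderivn U i.+1) x) j 0 = (mass_deriv U j 0)^`(i).[x].
Proof.
rewrite !mxE linear_sum horner_sum; apply: eq_bigr => l _.
by rewrite linearZ hornerZ /= !mxE derivSn.
Qed.

Lemma size_mass_deriv U j s : vpoly_le s.+1 U ->
  (size (mass_deriv U j 0%R) <= s.+1)%N.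
Proof.
move=> sU; rewrite mxE; apply: (leq_trans (size_sum _ _ _)).
apply/bigmax_leqP => l _; apply: (leq_trans (size_scale_leq _ _)).
by apply: leq_trans (size_poly _ _) _; rewrite -subn1 leq_subLR; exact: sU.
Qed.

Lemma size_dot U phi s m : (forall j, (size (U j 0%R) <= s)%N) ->
  vpoly_le m phi -> (size (dot U phi) <= s + m)%N.
Proof.
move=> sU sp; apply: (leq_trans (size_sum _ _ _)); apply/bigmax_leqP => j _.
apply: (leq_trans (size_polyMleq _ _)).
have := sU j; have := sp j; lia.
Qed.

Let Aa : `[a, b]%classic a. Proof. by rewrite /= in_itv /= lexx ltW. Qed.
Let Ab : `[a, b]%classic b. Proof. by rewrite /= in_itv /= lexx andbT ltW. Qed.

Lemma smooth_FU U : smooth a b k./2 (FU U).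
Proof.
by have [] := contact_comp a b ab k./2 0 F U U a Aa isT F_smooth
  (fun j i (i0 : (i < 0)%N) => erefl).
Qed.

Lemma smooth_FU_coord U j : smooth a b k./2 (fun t => FU U t j 0).
Proof.
have c : contact a b a 0 k./2 (FU U) (FU U).
  by split=> //; exact: smooth_FU.
by have [] := contact_coord a b ab d _ _ j _ _ _ Aa (leq0n _) c.
Qed.

Lemma deriven_FU_coord U j i x : (i <= k./2)%N -> `[a, b]%classic x ->
  deriven_within `[a, b] i (fun t => FU U t j 0) x =
  deriven_within `[a, b] i (FU U) x j 0.
Proof.
move=> ik Ax.
exact: (deriven_within_coord a b ab d (FU U) j _ _ _ (smooth_FU U) ik Ax).
Qed.

Lemma uphalf_pred : (0 < k)%N -> uphalf k = k.-1./2.+1.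
Proof. by case: k => // k' _; rewrite uphalfE. Qed.

(** The three families of collocation equations are the Hermite data at b, at a
    and at the inner nodes. *)
Lemma collocation_dataP W :
  (forall j, data_eq (fun t => FU W t j 0) (horner (mass_deriv W j 0))) <->
  [/\ forall i, (i <= k./2)%N ->
        M *m vhorner (vderivn W i.+1) b = deriven_within `[a, b] i (FU W) b,
      (1 <= k)%N -> forall i, (i <= k.-1./2)%N ->
        M *m vhorner (vderivn W i.+1) a = deriven_within `[a, b] i (FU W) a &
      forall x, jacobi_nodes r k x ->
        M *m vhorner (vderivn W 1) (aff a b x) = FU W (aff a b x)].
Proof.
have [_ _ _ _ JN] := @ref_nodesP R r k.
have pk i : (0 < k)%N -> (i <= k.-1./2)%N -> (i <= k./2)%N.
  by move=> k0 ik; rewrite (leq_trans ik) // half_leq // leq_pred.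
split=> [H|[Hb Ha Hx] j].
  have {}H j := (data_eq_polyP r k a b ab _ _ (smooth_FU_coord W j)).1 (H j).
  split=> [i ik|k0 i ik|x Jx]; apply/colP => j; have [Ha Hb Hz] := H j.
  - by rewrite mass_derivE -Hb // deriven_FU_coord.
  - by rewrite mass_derivE -Ha ?uphalf_pred // deriven_FU_coord // pk.
  - by rewrite mass_derivE -Hz // map_f // -JN.
apply/(data_eq_polyP r k a b ab _ _ (smooth_FU_coord W j)).
split=> [i ia|i ib|z /mapP[x xz ->]].
- have k0 : (0 < k)%N by case: k ia.
  move: ia; rewrite uphalf_pred // ltnS => ia.
  by rewrite deriven_FU_coord ?pk // -Ha // mass_derivE.
- by rewrite deriven_FU_coord // -Hb // mass_derivE.
- by rewrite -Hx ?JN // mass_derivE.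
Qed.

Lemma inner_data (f : R -> 'cV[R]_d) U phi :
  (forall j, data_eq (fun t => f t j 0) (horner (U j 0))) ->
  data_eq (fun t => inner (f t) (vhorner phi t)) (horner (dot U phi)).
Proof.
move=> H.
have -> : (fun t => inner (f t) (vhorner phi t)) =
    (fun t => \sum_j (phi j 0).[t] *: (f t j 0 : R)).
  by apply/funext => t; apply: eq_bigr => j _; rewrite mxE mulrC.
have -> : horner (dot U phi) =
    (fun t => \sum_j (phi j 0).[t] *: ((U j 0).[t] : R)).
  apply/funext => t; rewrite horner_sum; apply: eq_bigr => j _.
  by rewrite hornerM mulrC.
by apply: data_eq_sum => // j; apply: data_eq_polyZ.
Qed.

Lemma quad_inner (f : R -> 'cV[R]_d) U phi : (forall j, (size (U j 0%R) <= r.+1)%N) ->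
  vpoly_le (r - k) phi ->
  (forall j, data_eq (fun t => f t j 0) (horner (U j 0))) ->
  quad r k a b (fun t => inner (f t) (vhorner phi t)) = intp a b (dot U phi).
Proof.
move=> sU sp H; apply: quad_exact => //; first exact: inner_data.
by rewrite addnC; apply: size_dot.
Qed.

Lemma quad_mass_deriv U phi : vpoly_le r U -> vpoly_le (r - k) phi ->
  quad r k a b (fun t => inner (M *m vhorner (vderivn U 1) t) (vhorner phi t)) =
  intp a b (dot (mass_deriv U) phi).
Proof.
move=> sU sp; apply: (quad_inner (fun t => M *m vhorner (vderivn U 1) t)) => // j.
  by apply: size_mass_deriv => i; apply: leq_trans (sU i) _.
have -> : (fun t => (M *m vhorner (vderivn U 1) t) j 0) =
    horner (mass_deriv U j 0) by apply/funext => t; rewrite mass_derivE.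
by apply: data_eq_poly; rewrite ?subrr.
Qed.

Lemma mass_derivD U W c j : (forall l, W l 0 = U l 0 + c l 0 *: om) ->
  mass_deriv W j 0 = mass_deriv U j 0 + (M *m c) j 0 *: om^`().
Proof.
move=> WU; rewrite !mxE scaler_suml -big_split /=; apply: eq_bigr => l _.
by rewrite WU derivD derivZ scalerDr scalerA.
Qed.

(** Integration by parts: the multiple of the nodal polynomial by which W and
    U differ is orthogonal to phi' and vanishes at b, and at a unless k = 0,
    which leaves just the jump term of the discontinuous Galerkin case. *)
Lemma intp_mass_deriv U W c phi : (forall l, W l 0 = U l 0 + c l 0 *: om) ->
  vpoly_le (r - k) phi ->
  intp a b (dot (mass_deriv W) phi) = intp a b (dot (mass_deriv U) phi)
    + (k == 0)%:R * inner (M *m (vhorner U a - vhorner W a)) (vhorner phi a).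
Proof.
move=> WU sp.
have -> : dot (mass_deriv W) phi = dot (mass_deriv U) phi +
    \sum_j (M *m c) j 0 *: (om^`() * phi j 0).
  rewrite /dot -big_split /=; apply: eq_bigr => j _.
  by rewrite (mass_derivD _ _ _ _ WU) mulrDl scalerAl.
rewrite intpD; congr (_ + _).
have -> : vhorner U a - vhorner W a = - om.[a] *: c.
  apply/colP => j; rewrite !mxE WU hornerD hornerZ; ring.
transitivity (inner (M *m (- om.[a] *: c)) (vhorner phi a)).
  rewrite intp_sum; apply: eq_bigr => j _; rewrite intpZ intp_node_poly_parts //.
  rewrite -scalemxAr !mxE; ring.
have := node_poly_a r k a b ab; case: posnP => [-> _|k0 /eqP ->].
  by rewrite mul1r.
rewrite oppr0 scale0r mulmx0 /inner big1 ?mulr0 // => j _.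
by rewrite mxE mul0r.
Qed.

Lemma vhermiteE W j : vhermite r k a b (vhorner W) j 0 = W j 0 %% om.
Proof.
rewrite mxE; apply: hermiteE => //.
have -> : (fun t => vhorner W t j 0) = horner (W j 0).
  by apply/funext => t; rewrite mxE.
by apply: data_eq_poly; rewrite ?subrr.
Qed.

Lemma modp_om U W c : vpoly_le r U -> (forall l, W l 0 = U l 0 + c l 0 *: om) ->
  forall l, W l 0 %% om = U l 0.
Proof.
move=> sU WU l; apply/esym; apply: (@modpP _ _ ((c l 0)%:P)).
  by rewrite WU mul_polyC addrC.
by rewrite size_node_poly //; exact: sU.
Qed.

Lemma vderivn_data U W i : (forall l, om %| U l 0 - W l 0) ->
  ((i < k./2.+1)%N -> vhorner (vderivn U i) b = vhorner (vderivn W i) b) /\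
  ((i < uphalf k)%N -> vhorner (vderivn U i) a = vhorner (vderivn W i) a).
Proof.
move=> UW; have H l := (node_poly_dvdP r k a b ab _ _).1 (UW l).
by split=> ik; apply/colP => l; rewrite !mxE; case: (H l) => Ha Hb _;
  [apply: Hb|apply: Ha].
Qed.

(** U = W mod node_poly has the data of W, so F(., U) has the data of F(., W),
    which by collocation are those of M W'; both integrands are then integrated
    as polynomials of degree at most 2 r - k. *)
Lemma collocation_vtd W : collocation_solution M F a b uprev r k W ->
  vtd_solution M F a b uprev r k (vhermite r k a b (vhorner W)).
Proof.
move=> [sW Wa Wb Wa' Wx]; set U := vhermite _ _ _ _ _.
have om0 := monic_neq0 (node_poly_monic r k a b).
have UE j : U j 0 = W j 0 %% om by exact: vhermiteE.
have sU : vpoly_le r U.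
  by move=> j; rewrite UE; have := ltn_modpN0 (W j 0) om0; rewrite size_node_poly.
have UW j : om %| U j 0 - W j 0.
  by rewrite UE {2}(divp_eq (W j 0) om) opprD addrCA subrr addr0 -mulNr dvdp_mull.
pose c : 'cV[R]_d := \col_j (W j 0 %/ om)`_0.
have WU j : W j 0 = U j 0 + c j 0 *: om.
  rewrite UE mxE -mul_polyC -size1_polyC; first by rewrite addrC -divp_eq.
  by rewrite size_divp // size_node_poly //= leq_subLR addn1; exact: sW.
have [Fa Fb _] := data_eq_comp r k a b ab d F U W F_smooth UW.
have HW : forall j, data_eq (fun t => FU W t j 0) (horner (mass_deriv W j 0)).
  exact/collocation_dataP.
have HU j : data_eq (fun t => FU U t j 0) (horner (mass_deriv W j 0)).
  apply: data_eq_trans (HW j); apply: (data_eq_coord r k a b ab _ (FU U)).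
  exact: data_eq_comp.
split=> //.
- move=> k1; rewrite -Wa; have [_] := vderivn_data _ _ 0 UW.
  have vh0 V : vderivn V 0 = V by apply/colP => j; rewrite mxE.
  by rewrite !vh0; apply; rewrite uphalf_gt0.
- move=> _ i ik; have [-> // _] := vderivn_data _ _ i.+1 UW.
  rewrite Wb; last exact: ltnW.
  by case: Fb => _ _ ->; rewrite // ltnS ltnW.
- move=> k3 i ik; have k0 : (0 < k)%N by apply: leq_trans k3.
  have [_ ->] := vderivn_data _ _ i.+1 UW; last by rewrite uphalf_pred.
  rewrite Wa' //; last exact: ltnW.
  by case: Fa => _ _ ->; rewrite // uphalf_pred // ltnS ltnW.
- move=> phi sp; rewrite quad_mass_deriv //.
  rewrite (quad_inner (FU U) (mass_deriv W)) //.
    by rewrite (intp_mass_deriv _ _ _ _ WU sp) Wa.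
  by move=> j; apply: size_mass_deriv.
Qed.

(** Each summand has a nonnegative integral, so all of them vanish. *)
Lemma weighted_squares_eq0 (w : {poly R}) (s : 'I_d -> {poly R}) :
  w != 0 -> (forall x, a <= x <= b -> 0 <= w.[x]) ->
  intp a b (\sum_j w * s j * s j) = 0 -> forall j, s j = 0.
Proof.
move=> w0 wge0; rewrite intp_sum => /eqP.
rewrite psumr_eq0 => [/allP H j|j _].
  by apply: (intp_sqr_eq0 a b w) => //; apply/eqP/(implyP (H j _)).
apply: intp_ge0 (ltW ab) _ => x xab.
by rewrite !hornerM -mulrA mulr_ge0 ?wge0 // -expr2 sqr_ge0.
Qed.

(** A residual in P_r with k prescribed zeros at the ends has the form v s with
    v of constant sign and s of degree at most r - k, so it can be tested
    against s. *)
Lemma residual_eq0 e f (rho : 'cV[{poly R}]_d) : (e + f)%N = k ->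
  vpoly_le r rho -> (forall j, nodal e f a b [::] %| rho j 0) ->
  (forall phi, vpoly_le (r - k) phi -> intp a b (dot rho phi) = 0) ->
  forall j, rho j 0 = 0.
Proof.
move=> efk sr dvr ort; set v := nodal e f a b [::] in dvr.
have vm : v \is monic by exact: nodal_monic.
have v0 := monic_neq0 vm.
pose s j := rho j 0 %/ v.
have sE j : rho j 0 = v * s j by rewrite mulrC divpK.
suff s0 j : s j = 0 by move=> j; rewrite sE s0 mulr0.
move: j; apply: (@weighted_squares_eq0 ((-1) ^+ f *: v)).
- by rewrite scaler_eq0 signr_eq0.
- move=> x /andP[ax xb]; rewrite hornerZ /v /nodal big_nil mulr1.
  rewrite hornerM !horner_exp !hornerXsubC mulrCA -exprMn mulN1r opprB.
  by rewrite mulr_ge0 // exprn_ge0 // subr_ge0.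
- have := ort (\col_j s j).
  have -> : dot rho (\col_j s j) = \sum_j v * s j * s j.
    by apply: eq_bigr => j _; rewrite mxE sE.
  move=> I0; rewrite (eq_bigr (fun j => (-1) ^+ f *: (v * s j * s j))).
    rewrite -scaler_sumr intpZ I0 ?mulr0 // => j.
    rewrite mxE size_divp // size_nodal /= addn0 efk leq_subLR.
    by rewrite addnS subnKC //; exact: sr.
  by move=> j _; rewrite -!scalerAl.
Qed.

(** The one free vector c in W = U + c node_poly is spent on what U does not
    satisfy: the initial value when k = 0, and otherwise the collocation equation
    of highest order at b, the initial value being kept since node_poly(a) = 0. *)
Lemma correction U (Q : 'cV[{poly R}]_d) :
  ((1 <= k)%N -> vhorner U a = uprev) ->
  exists c, forall W, (forall l, W l 0 = U l 0 + c l 0 *: om) ->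
    vhorner W a = uprev /\
    ((0 < k)%N -> forall j,
      (mass_deriv W j 0)^`(k./2).[b] = (Q j 0)^`(k./2).[b]).
Proof.
move=> U0; have oma := node_poly_a r k a b ab.
have Wa W c : (forall l, W l 0 = U l 0 + c l 0 *: om) ->
    vhorner W a = vhorner U a + om.[a] *: c.
  by move=> WU; apply/colP => j; rewrite !mxE WU hornerD hornerZ mulrC.
have [k0|k0] := posnP k.
  have a0 : om.[a] != 0 by rewrite oma k0.
  exists (om.[a]^-1 *: (uprev - vhorner U a)) => W /Wa ->.
  by split; [rewrite scalerA divff // scale1r addrC subrK | rewrite k0].
have {}oma : om.[a] = 0 by apply/eqP; rewrite oma.
pose y := \col_j ((Q j 0)^`(k./2).[b] - (mass_deriv U j 0)^`(k./2).[b]).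
have b0 := node_poly_derivn_b_neq0 r k a b ab.
set z := (om^`(k./2.+1)).[b] in b0.
exists (z^-1 *: (invmx M *m y)) => W WU; split.
  by rewrite (Wa _ _ WU) oma scale0r addr0 U0.
move=> _ j; rewrite (mass_derivD _ _ _ _ WU) -scalemxAr mulKVmx //.
rewrite derivnD derivnZ -derivSn hornerD hornerZ -/z !mxE.
by rewrite mulrAC mulVf // mul1r addrC subrK.
Qed.

(** With Q the Hermite interpolant of F(., U), the residual Q - M W' vanishes at
    the ends by the equations imposed there and by the choice of W, k conditions
    in all, and the variational equation makes it orthogonal to all test
    polynomials; hence it is zero, which is collocation for W. *)
Lemma vtd_collocation U : vtd_solution M F a b uprev r k U ->
  exists2 W, collocation_solution M F a b uprev r k W &
    forall j, W j 0 %% om = U j 0.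
Proof.
move=> [sU U0 Ub Ua UQ].
have Q_ex j : exists q : {poly R}, (size q <= r.+1)%N /\
    data_eq (fun t => FU U t j 0) (horner q).
  have [q sq qd] := data_eq_interpolant r k a b ab kr _ (smooth_FU_coord U j).
  by exists q.
have [Qf Qf_prop] := fin_all_exists Q_ex.
pose Q : 'cV[{poly R}]_d := \col_j Qf j.
have sQ j : (size (Q j 0%R) <= r.+1)%N by rewrite mxE; case: (Qf_prop j).
have HQ j : data_eq (fun t => FU U t j 0) (horner (Q j 0)).
  by rewrite mxE; case: (Qf_prop j).
have [c cP] := correction U Q U0.
pose W : 'cV[{poly R}]_d := \col_j (U j 0 + c j 0 *: om).
have WU j : W j 0 = U j 0 + c j 0 *: om by rewrite mxE.
have [Wa Wtop] := cP W WU.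
have UW j : om %| U j 0 - W j 0.
  by rewrite WU opprD addrA subrr sub0r -scaleNr -mul_polyC dvdp_mull.
have sW : vpoly_le r.+1 W.
  move=> j; rewrite WU (leq_trans (size_polyD _ _)) // geq_max.
  rewrite (leq_trans (sU j)) //=.
  by rewrite (leq_trans (size_scale_leq _ _)) // size_node_poly.
exists W; last exact: modp_om.
have QE j i : ((i < k./2.+1)%N ->
      (Q j 0)^`(i).[b] = deriven_within `[a, b] i (FU U) b j 0) /\
    ((i < uphalf k)%N ->
      (Q j 0)^`(i).[a] = deriven_within `[a, b] i (FU U) a j 0).
  have [Qa Qb _] := (data_eq_polyP r k a b ab _ _ (smooth_FU_coord U j)).1 (HQ j).
  split=> ik; first by rewrite -Qb // deriven_FU_coord.
  rewrite -Qa // deriven_FU_coord //.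
  by rewrite -ltnS (leq_trans ik) // uphalf_leS.
suff QW j : Q j 0 = mass_deriv W j 0.
  have HW j : data_eq (fun t => FU W t j 0) (horner (mass_deriv W j 0)).
    rewrite -QW; apply: data_eq_trans (HQ j); apply: data_eq_sym.
    apply: (data_eq_coord r k a b ab _ (FU U)); exact: data_eq_comp.
  by have [] := (collocation_dataP W).1 HW; split.
pose rho : 'cV[{poly R}]_d := Q - mass_deriv W.
have rhoE l : rho l 0 = Q l 0 - mass_deriv W l 0 by rewrite !mxE.
apply/eqP; rewrite -subr_eq0 -rhoE; apply/eqP.
have rhoD l i x : (rho l 0)^`(i).[x] = (Q l 0)^`(i).[x] - (mass_deriv W l 0)^`(i).[x].
  by rewrite rhoE derivnB hornerD hornerN.
pose e := if k == 0%N then 0%N else k.-1./2.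
pose f := if k == 0%N then 0%N else k./2.+1.
(* For k > 0 these are uphalf k - 1 conditions at a and k./2 + 1 at b. *)
apply: (residual_eq0 e f).
- by rewrite /e /f; case: eqP => //; have := uphalf_half_sum k; lia.
- move=> l; rewrite rhoE (leq_trans (size_polyD _ _)) // size_polyN geq_max sQ.
  exact: size_mass_deriv.
- move=> l; apply/nodal_dvdP; rewrite ?lt_eqF // /e /f.
  have [k0|k0] := eqVneq k 0%N; first by split.
  have {}k0 : (0 < k)%N by rewrite lt0n.
  split=> // i ik; apply/eqP; rewrite rhoD subr_eq0 eq_sym; apply/eqP.
    have [_ ->] := QE l i; last by rewrite uphalf_pred // ltnS ltnW.
    rewrite -Ua //; last by lia.
    rewrite -mass_derivE; congr ((M *m _) l 0); apply/esym.
    by have [_] := vderivn_data _ _ i.+1 UW; apply; rewrite uphalf_pred.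
  move: ik; rewrite ltnS leq_eqVlt => /predU1P[->|ik]; first exact: Wtop.
  have [QEb _] := QE l i; rewrite QEb; last by rewrite ltnS ltnW.
  rewrite -Ub //; last by lia.
  rewrite -mass_derivE; congr ((M *m _) l 0); apply/esym.
  by have [H _] := vderivn_data _ _ i.+1 UW; apply: H.
- move=> phi sp.
  have -> : dot rho phi = dot Q phi - dot (mass_deriv W) phi.
    by rewrite /dot -sumrB; apply: eq_bigr => l _; rewrite rhoE mulrBl.
  rewrite intpB (intp_mass_deriv _ _ _ _ WU sp) Wa.
  rewrite -(quad_inner (FU U) Q phi sQ sp HQ) -quad_mass_deriv //.
  by rewrite UQ // subrr.
Qed.

End Equivalence.

Theorem corollary4p6 (R : realType) (d : nat) (M : 'M[R]_d)
    (F : R -> 'cV[R]_d -> 'cV[R]_d) (a b : R) (uprev : 'cV[R]_d) (r k : nat)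
    (M_regular : M \in unitmx)
    (a_lt_b : a < b)
    (k_le_r : (k <= r)%N)
    (F_smooth : Cn_on `[a, b] k./2 F)
    (F_lipschitz : exists L : R, forall t, t \in `[a, b] -> L.-lipschitz (F t)) :
  (forall W : 'cV[{poly R}]_d,
     collocation_solution M F a b uprev r k W ->
     vtd_solution M F a b uprev r k (vhermite r k a b (vhorner W))) /\
  (forall W : 'cV[{poly R}]_d,
     unique (collocation_solution M F a b uprev r k) W ->
     unique (vtd_solution M F a b uprev r k) (vhermite r k a b (vhorner W))).
Proof.
have fwd W : collocation_solution M F a b uprev r k W ->
    vtd_solution M F a b uprev r k (vhermite r k a b (vhorner W)).
  exact: collocation_vtd.
split=> // W [cW uW]; split=> [|U vU]; first exact: fwd.
have [V cV VU] := vtd_collocation _ _ _ _ _ _ _ M_regular a_lt_b k_le_r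
  F_smooth _ vU.
by apply/colP => j; rewrite vhermiteE // (uW V cV) VU.
Qed.
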